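(* Assume that $H$ is a Gorenstein ring. The functors $$U:\mathrm{Rep}^\infty_k(G)\to\mathrm{Mod}(H)\quad\text{and}\quad\mathbb{F}:\mathrm{Mod}(H)\to\mathrm{Rep}^\infty_k(G)$$ restrict to inverse equivalences of categories $\mathcal{C}(G)\cong\mathrm{GProj}(H)$ between the full subcategory $\mathcal{C}(G)$ of $I$-Gorenstein projective $G$-representations and the full subcategory $\mathrm{GProj}(H)$ of Gorenstein projective $H$-modules.
   Context: Let $p$ be a prime, $k$ a field of characteristic $p$, and $G$ a topological group (possibly discrete) admitting an open subgroup $I$ which is pro-$p$. $\mathrm{Rep}_k^\infty(G)$ is the category of smooth $k$-linear $G$-representations (the stabilizer of every vector is open). $\mathbb{X}=\mathrm{ind}_I^G(k)$ is the space of compactly supported maps $f:G\to k$ with $f(gi)=f(g)$ for $g\in G$, $i\in I$, with $(gf)(g')=f(g^{-1}g')$. Let $H=\mathrm{End}_G(\mathbb{X})^{\mathrm{op}}$, so $\mathbb{X}$ is a right $H$-module; $\mathrm{Mod}(H)$ is the category of left $H$-modules. There is an adjunction $F:\mathrm{Mod}(H)\rightleftarrows\mathrm{Rep}^\infty_k(G):U$ ($F$ left adjoint), $FM=\mathbb{X}\otimes_HM$, $UV=V^I\cong\mathrm{Hom}_G(\mathbb{X},V)$, extended termwise to unbounded chain complexes. A ring is Gorenstein if it is left and right noetherian and has finite injective dimension as a left and as a right module over itself. An $H$-module $M$ is Gorenstein projective if $M=\ker(d_0)=\mathrm{im}(d_1)$ for an acyclic complex $(Y_\bullet,d_\bullet)$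 of projective $H$-modules (with differentials $d_n:Y_n\to Y_{n-1}$) which stays exact under $\mathrm{Hom}_H(\cdot,P)$ for every projective $P$. A $G$-representation is $I$-projective if it is (isomorphic to) a direct summand of $FP$ for some projective $H$-module $P$. A sequence $V_1\to V_2\to V_3$ in $\mathrm{Rep}^\infty_k(G)$ is $I$-exact if it is a complex and $UV_1\to UV_2\to UV_3$ is exact. For a complex $X$ put $B_0X=\mathrm{im}(d_1:X_1\to X_0)$, $Z_0X=\ker(d_0)$. A representation $V$ is $I$-Gorenstein projective if $V\cong B_0X$ for some $I$-exact complex $X=(X_\bullet,d_\bullet)$, $X_n$ ($n\in\mathbb{Z}$), of $I$-projective $G$-representations. Functorial factorizations in the Gorenstein projective model structure on $\mathrm{Mod}(H)$ yield a (fixed) functor $M\mapsto Y^M=(Y^M_\bullet,d^M_\bullet)$ from $\mathrm{Mod}(H)$ to chain complexes of $H$-modules such that $Y^M$ is acyclic with $B_0Y^M=Z_0Y^M=M$, $Y^M_i$ is projective for $i\ge1$, $Y^M_i$ has finite projective dimension for $i\le0$, and $M$ is Gorenstein projective if and only if $Y_i^M$ is projective for all $i\in\mathbb{Z}$. The functor $\mathbb{F}$ is defined by $\mathbb{F}M=B_0FY^M$. *)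

(* Defs.v *)
From HB Require Import structures.
From mathcomp Require Import all_boot all_order all_algebra.
From mathcomp Require Import mathcomp_extra boolp classical_sets functions.
From mathcomp Require Import cardinality fsbigop topology.

Set Implicit Arguments.
Unset Strict Implicit.
Unset Printing Implicit Defensive.

Import Order.TTheory GRing.Theory Num.Theory.

Local Open Scope classical_set_scope.
Local Open Scope ring_scope.
Local Open Scope quotient_scope.

Record category := Category {
  obj :> Type;
  mor : obj -> obj -> Type;
  idm : forall x, mor x x;
  mcomp : forall x y z, mor y z -> mor x y -> mor x z;
  comp1m : forall x y (f : mor x y), mcomp (idm y) f = f;
  compm1 : forall x y (f : mor x y), mcomp f (idm x) = f;
  compmA : forall x y z t (h : mor z t) (g : mor y z) (f : mor x y),
    mcomp h (mcomp g f) = mcomp (mcomp h g) f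
}.
Arguments mor {c} x y.
Arguments idm {c} x.
Arguments mcomp {c x y z} g f.
Notation "g \oc f" := (mcomp g f) (at level 50, format "g  \oc  f").

Definition is_iso (C : category) (x y : C) (f : mor x y) : Prop :=
  exists g : mor y x, g \oc f = idm x /\ f \oc g = idm y.

Definition iso (C : category) (x y : C) : Prop := exists f : mor x y, is_iso f.

Record functor (C D : category) := Functor {
  fobj :> C -> D;
  fmor : forall x y, mor x y -> mor (fobj x) (fobj y);
  fmor1 : forall x, fmor (idm x) = idm (fobj x);
  fmorM : forall x y z (g : mor y z) (f : mor x y),
    fmor (g \oc f) = fmor g \oc fmor f
}.
Arguments fmor {_ _} _ {_ _} _.

Program Definition functor_id (C : category) : functor C C :=
  @Functor C C id (fun _ _ f => f) _ _.
Next Obligation. by []. Qed.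
Next Obligation. by []. Qed.

Program Definition functor_comp (C D E : category)
    (S : functor D E) (T : functor C D) : functor C E :=
  @Functor C E (fun x => S (T x)) (fun _ _ f => fmor S (fmor T f)) _ _.
Next Obligation. by move=> * /=; rewrite !fmor1. Qed.
Next Obligation. by move=> * /=; rewrite !fmorM. Qed.
Notation "S \of T" := (functor_comp S T) (at level 50, format "S  \of  T").

Definition nat_iso (C D : category) (S T : functor C D) : Prop :=
  exists eta : forall x, mor (S x) (T x),
    (forall x, is_iso (eta x)) /\
    (forall x y (f : mor x y), eta y \oc fmor S f = fmor T f \oc eta x).

Definition inverse_equivalences (C D : category)
    (S : functor C D) (T : functor D C) : Prop :=
  nat_iso (T \of S) (functor_id C) /\ nat_iso (S \of T) (functor_id D).

Program Definition full_subcategory (C : category) (P : C -> Prop) : category :=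
  @Category {x : C | P x} (fun x y => mor (sval x) (sval y))
    (fun x => idm (sval x)) (fun _ _ _ g f => g \oc f) _ _ _.
Next Obligation. move=> *; exact: comp1m. Qed.
Next Obligation. move=> *; exact: compm1. Qed.
Next Obligation. move=> *; exact: compmA. Qed.

Program Definition restrict (C D : category) (P : C -> Prop) (Q : D -> Prop)
    (S : functor C D) (SPQ : forall x, P x -> Q (S x)) :
    functor (full_subcategory P) (full_subcategory Q) :=
  @Functor (full_subcategory P) (full_subcategory Q)
    (fun x => exist Q (S (sval x)) (SPQ _ (svalP x)))
    (fun _ _ f => fmor S f) _ _.
Next Obligation. move=> *; exact: fmor1. Qed.
Next Obligation. move=> *; exact: fmorM. Qed.

Record zcategory := ZCategory {
  zcat :> category;
  zerom : forall x y : zcat, mor x y;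
  comp0m : forall x y z (f : mor x y), zerom y z \oc f = zerom x z;
  compm0 : forall x y z (g : mor y z), g \oc zerom x y = zerom x z
}.
Arguments zerom {_} _ _.

Record complex (C : zcategory) := Complex {
  cobj :> int -> C;
  cdiff : forall n : int, mor (cobj n) (cobj (n - 1));
  cdiffK : forall n : int,
    cdiff (n - 1) \oc cdiff n = zerom (cobj n) (cobj (n - 1 - 1))
}.
Arguments cdiff {_} _ _.

Record chain_map (C : zcategory) (X Y : complex C) := ChainMap {
  cmap :> forall n : int, mor (X n) (Y n);
  cmap_diff : forall n : int, cdiff Y n \oc cmap n = cmap (n - 1) \oc cdiff X n
}.

Lemma chain_map_eq (C : zcategory) (X Y : complex C) (f g : chain_map X Y) :
  (forall n, f n = g n) -> f = g.
Proof.
case: f g => [f fP] [g gP] /= fg.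
have E : f = g by exact: functional_extensionality_dep.
by case: _ / E gP => gP; congr ChainMap; exact: Prop_irrelevance.
Qed.

Program Definition chain_id (C : zcategory) (X : complex C) : chain_map X X :=
  @ChainMap C X X (fun n => idm (X n)) _.
Next Obligation. by move=> * /=; rewrite comp1m compm1. Qed.

Program Definition chain_comp (C : zcategory) (X Y Z : complex C)
    (g : chain_map Y Z) (f : chain_map X Y) : chain_map X Z :=
  @ChainMap C X Z (fun n => g n \oc f n) _.
Next Obligation. by move=> * /=; rewrite compmA cmap_diff -!compmA cmap_diff. Qed.

Program Definition Ch (C : zcategory) : category :=
  @Category (complex C) (@chain_map C) (@chain_id C) (@chain_comp C) _ _ _.
Next Obligation. move=> *; apply: chain_map_eq => n; exact: comp1m. Qed.
Next Obligation. move=> *; apply: chain_map_eq => n; exact: compm1. Qed.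
Next Obligation. move=> *; apply: chain_map_eq => n; exact: compmA. Qed.

Section Termwise.
Context (C D : zcategory) (S : functor C D).
Context (S0 : forall x y : C, fmor S (zerom x y) = zerom (S x) (S y)).

Program Definition termwise_obj (X : complex C) : complex D :=
  @Complex D (fun n => S (X n)) (fun n => fmor S (cdiff X n)) _.
Next Obligation. by move=> * /=; rewrite -fmorM cdiffK S0. Qed.

Program Definition termwise_map (X Y : complex C) (f : chain_map X Y) :
    chain_map (termwise_obj X) (termwise_obj Y) :=
  @ChainMap D (termwise_obj X) (termwise_obj Y) (fun n => fmor S (f n)) _.
Next Obligation. by move=> * /=; rewrite -!fmorM cmap_diff. Qed.

Program Definition termwise : functor (Ch C) (Ch D) :=
  @Functor (Ch C) (Ch D) termwise_obj termwise_map _ _.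
Next Obligation. move=> *; apply: chain_map_eq => n; exact: fmor1. Qed.
Next Obligation. move=> *; apply: chain_map_eq => n; exact: fmorM. Qed.
End Termwise.

Lemma linear_eq (R : pzRingType) (M N : lmodType R) (f g : {linear M -> N}) :
  f =1 g -> f = g.
Proof.
move=> /funext; case: f g => [f cf] [g cg] /= E.
case: _ / E cg => cg; congr GRing.Linear.Pack.
case: cf cg => [[a] [b]] [[a'] [b']].
by rewrite (Prop_irrelevance a a') (Prop_irrelevance b b').
Qed.

Section Modules.
Context (R : pzRingType).
Implicit Types L M N : lmodType R.

Definition lin_id M : {linear M -> M} := idfun.
Definition lin_comp L M N (g : {linear M -> N}) (f : {linear L -> M}) :
  {linear L -> N} := g \o f.
Definition lin_zero M N : {linear M -> N} := \0.

Program Definition ModC : category :=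
  @Category (lmodType R) (fun M N => {linear M -> N}) lin_id lin_comp _ _ _.
Next Obligation. by move=> *; apply: linear_eq. Qed.
Next Obligation. by move=> *; apply: linear_eq. Qed.
Next Obligation. by move=> *; apply: linear_eq. Qed.

Program Definition Mod : zcategory := @ZCategory ModC lin_zero _ _.
Next Obligation. by move=> *; apply: linear_eq. Qed.
Next Obligation. move=> *; apply: linear_eq => v /=; exact: linear0. Qed.

Definition exact_at L M N (f : {linear L -> M}) (g : {linear M -> N}) : Prop :=
  forall y, g y = 0 <-> exists x, f x = y.

Definition short_exact L M N (f : {linear L -> M}) (g : {linear M -> N}) : Prop :=
  [/\ injective f, exact_at f g & forall z, exists y, g y = z].

Definition projective_module (P : lmodType R) : Prop :=
  forall M N (q : {linear M -> N}) (f : {linear P -> N}),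
    (forall y, exists x, q x = y) -> exists g : {linear P -> M}, f =1 q \o g.

Definition injective_module (E : lmodType R) : Prop :=
  forall M N (i : {linear M -> N}) (f : {linear M -> E}),
    injective i -> exists g : {linear N -> E}, f =1 g \o i.

(* A resolution 0 -> M -> E_0 -> ... -> E_n -> 0 is spliced from short exact
   sequences; dually for the projective dimension. *)
Fixpoint injdim_le (n : nat) (M : lmodType R) : Prop :=
  if n is n'.+1 then
    exists (E N : lmodType R) (i : {linear M -> E}) (q : {linear E -> N}),
      [/\ injective_module E, short_exact i q & injdim_le n' N]
  else injective_module M.

Fixpoint projdim_le (n : nat) (M : lmodType R) : Prop :=
  if n is n'.+1 then
    exists (P N : lmodType R) (i : {linear N -> P}) (q : {linear P -> M}),
      [/\ projective_module P, short_exact i q & projdim_le n' N]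
  else projective_module M.

Definition finite_injdim (M : lmodType R) : Prop := exists n, injdim_le n M.
Definition finite_projdim (M : lmodType R) : Prop := exists n, projdim_le n M.

Definition left_ideal (J : set R) : Prop :=
  [/\ J 0, forall x y, J x -> J y -> J (x + y) & forall a x, J x -> J (a * x)].

Definition left_noetherian : Prop :=
  forall J, left_ideal J -> exists (n : nat) (a : 'I_n -> R),
    J = [set x | exists c : 'I_n -> R, x = \sum_(i < n) c i * a i].

End Modules.
Arguments Mod R : clear implicits.

Definition gorenstein_ring (R : pzRingType) : Prop :=
  [/\ left_noetherian R, left_noetherian R^c,
      finite_injdim (R^o : lmodType R) &
      finite_injdim ((R^c)^o : lmodType R^c)].

Section Kernel.
Context (R : pzRingType) (M N : lmodType R) (f : {linear M -> N}).

Definition kerp : {pred M} := [pred x | f x == 0].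
Lemma kerpP x : reflect (f x = 0) (x \in kerp).
Proof. by rewrite inE; exact: eqP. Qed.

Fact kerp_submod : GRing.submod_closed kerp.
Proof.
split=> [|a x y /kerpP fx /kerpP fy]; first by apply/kerpP; exact: linear0.
by apply/kerpP; rewrite linearP fx fy scaler0 addr0.
Qed.
HB.instance Definition _ := GRing.isSubmodClosed.Build R M kerp kerp_submod.

Definition ker_sub := {x : M | x \in kerp}.
HB.instance Definition _ := SubChoice.on ker_sub.
HB.instance Definition _ := [SubChoice_isSubLmodule of ker_sub by <:].
Definition ker_mod : lmodType R := ker_sub.

Definition ker_in (x : M) (fx : f x = 0) : ker_mod :=
  exist (fun x => x \in kerp) x (introT (kerpP x) fx).
Definition ker_val : {linear ker_mod -> M} := (val : ker_sub -> M).
Lemma ker_valK (x : ker_mod) : f (ker_val x) = 0.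
Proof. exact/kerpP/(valP x). Qed.
Lemma ker_val_inj : injective ker_val. Proof. exact: val_inj. Qed.
End Kernel.
Arguments ker_val {R M N f}.
Arguments ker_val_inj {R M N f}.

Section Cycles.
Context (R : pzRingType).
Implicit Types X Y : complex (Mod R).

Definition acyclic X : Prop :=
  forall n : int, exact_at (cdiff X n) (cdiff X (n - 1)).

Definition cycles0 X : lmodType R := ker_mod (cdiff X 0).

Lemma cycles0_subproof X Y (f : chain_map X Y) (x : cycles0 X) :
  (cdiff Y 0 : {linear _ -> _}) ((f 0 : {linear _ -> _}) (ker_val x)) = 0.
Proof.
have /(congr1 (fun h : {linear _ -> _} => h (ker_val x))) /= -> := cmap_diff f 0.
by rewrite ker_valK; exact: linear0.
Qed.

Definition cycles0_fun X Y (f : chain_map X Y) (x : cycles0 X) : cycles0 Y :=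
  ker_in (cycles0_subproof f x).

Fact cycles0_linear X Y (f : chain_map X Y) : linear (cycles0_fun f).
Proof. by move=> a x y; apply: ker_val_inj; rewrite /= linearP. Qed.
HB.instance Definition _ X Y (f : chain_map X Y) :=
  GRing.isLinear.Build R (cycles0 X) (cycles0 Y) *:%R (cycles0_fun f)
    (cycles0_linear f).

Definition cycles0_map X Y (f : chain_map X Y) :
  {linear cycles0 X -> cycles0 Y} := cycles0_fun f.

Program Definition Z0 : functor (Ch (Mod R)) (Mod R) :=
  @Functor (Ch (Mod R)) (Mod R) cycles0 cycles0_map _ _.
Next Obligation. by move=> *; apply: linear_eq => v; exact: ker_val_inj. Qed.
Next Obligation. by move=> *; apply: linear_eq => v; exact: ker_val_inj. Qed.

(* Exactness of Hom(X, P) at Hom(X_(n-1), P), for every n. *)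
Definition hom_exact X (P : Mod R) : Prop :=
  forall (n : int) (f : mor (X (n - 1)) P),
    f \oc cdiff X n = zerom _ _ <->
    exists g : mor (X (n - 1 - 1)) P, g \oc cdiff X (n - 1) = f.

Definition gorenstein_projective (M : Mod R) : Prop :=
  exists X : complex (Mod R),
    [/\ acyclic X, forall n, projective_module (X n),
        forall P, projective_module P -> hom_exact X P & iso M (Z0 X)].

(* The functor M |-> Y^M coming from the functorial factorizations of the
   Gorenstein projective model structure, with its properties; acyclicity turns
   the identification of Z_0 Y^M with M into one of B_0 Y^M as well. *)
Record gproj_resolution := GProjResolution {
  gpY :> functor (Mod R) (Ch (Mod R));
  gpY_acyclic : forall M, acyclic (gpY M : complex _);
  gpY_cycles : nat_iso (Z0 \of gpY) (functor_id (Mod R));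
  gpY_proj : forall M (i : int), 1 <= i ->
    projective_module ((gpY M : complex _) i);
  gpY_projdim : forall M (i : int), i <= 0 ->
    finite_projdim ((gpY M : complex _) i);
  gpY_gproj : forall M, gorenstein_projective M <->
    forall i : int, projective_module ((gpY M : complex _) i)
}.

End Cycles.

HB.mixin Record Group_isTopologicalGroup G of Group G & Topological G := {
  mulg_continuous : continuous (fun xy : G * G => (xy.1 * xy.2)%g);
  invg_continuous : continuous (fun x : G => x^-1%g)
}.
#[short(type="topologicalGroupType")]
HB.structure Definition TopologicalGroup :=
  {G of Group G & Topological G & Group_isTopologicalGroup G}.

Section ProP.
Context (G : topologicalGroupType).
Implicit Types I N : set G.

Definition subgroup_set I : Prop :=
  [/\ I 1%g, forall x y, I x -> I y -> I (x * y)%g & forall x, I x -> I x^-1%g].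

Definition normal_in N I : Prop :=
  [/\ subgroup_set N, N `<=` I &
      forall x n, I x -> N n -> N (x * n * x^-1)%g].

Definition left_coset I (x : G) : set G := [set y | I (x^-1 * y)%g].

Definition index_is N I (n : nat) : Prop := (left_coset N @` I #= `I_n)%card.

(* Since I is open in G, the open normal subgroups of I are open in G. *)
Definition pro_p (p : nat) I : Prop :=
  [/\ compact I, hausdorff_space (subspace I), totally_disconnected I &
      forall N, open N -> normal_in N I -> exists n, index_is N I (p ^ n)].
End ProP.

Record open_pro_p (p : nat) (G : topologicalGroupType) := OpenProP {
  oset :> set G;
  oset_subgroup : subgroup_set oset;
  oset_open : open oset;
  oset_pro_p : pro_p p oset
}.

Record smooth_rep (k : fieldType) (G : topologicalGroupType) := SmoothRep {
  rep_mod :> lmodType k;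
  act : G -> rep_mod -> rep_mod;
  act_linear : forall g, linear (act g);
  act1 : forall v, act 1%g v = v;
  actM : forall g h v, act (g * h)%g v = act g (act h v);
  act_smooth : forall v, open [set g | act g v = v]
}.
Arguments act {_ _ _} _ _.

HB.instance Definition _ (k : fieldType) (G : topologicalGroupType)
    (V : smooth_rep k G) (g : G) :=
  GRing.isLinear.Build k V V *:%R (@act k G V g) (@act_linear k G V g).

Record rep_hom (k : fieldType) (G : topologicalGroupType)
    (V W : smooth_rep k G) := RepHom {
  rhom :> {linear V -> W};
  rhom_act : forall g v, rhom (act g v) = act g (rhom v)
}.

Lemma rep_hom_eq (k : fieldType) (G : topologicalGroupType)
  (V W : smooth_rep k G) (f g : rep_hom V W) : f =1 g -> f = g.
Proof.
case: f g => [f fP] [g gP] /= /linear_eq E.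
by case: _ / E gP => gP; congr RepHom; exact: Prop_irrelevance.
Qed.

Section RepCategory.
Context (k : fieldType) (G : topologicalGroupType).
Implicit Types U V W : smooth_rep k G.

Program Definition rhom_id V : rep_hom V V := @RepHom k G V V (lin_id V) _.
Next Obligation. by []. Qed.

Program Definition rhom_comp U V W (g : rep_hom V W) (f : rep_hom U V) :
  rep_hom U W := @RepHom k G U W (lin_comp g f) _.
Next Obligation. by move=> * /=; rewrite !rhom_act. Qed.

Program Definition rhom_zero V W : rep_hom V W :=
  @RepHom k G V W (lin_zero V W) _.
Next Obligation. by move=> * /=; rewrite linear0. Qed.

Program Definition RepC : category :=
  @Category (smooth_rep k G) (@rep_hom k G) rhom_id rhom_comp _ _ _.
Next Obligation. by move=> *; apply: rep_hom_eq. Qed.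
Next Obligation. by move=> *; apply: rep_hom_eq. Qed.
Next Obligation. by move=> *; apply: rep_hom_eq. Qed.

Program Definition Rep : zcategory := @ZCategory RepC rhom_zero _ _.
Next Obligation. by move=> *; apply: rep_hom_eq. Qed.
Next Obligation. by move=> *; apply: rep_hom_eq => v /=; exact: linear0. Qed.
End RepCategory.
Arguments Rep k G : clear implicits.

Section TopGroupLemmas.
Context (G : topologicalGroupType).

Lemma mulgl_continuous (x : G) : continuous (fun y : G => (x * y)%g).
Proof.
move=> y; apply: (@continuous_comp _ _ _ (fun z : G => (x, z))
  (fun xy : G * G => (xy.1 * xy.2)%g)); last exact: mulg_continuous.
by apply: cvg_pair; [exact: cvg_cst|exact: cvg_id].
Qed.

Lemma mulgr_continuous (x : G) : continuous (fun y : G => (y * x)%g).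
Proof.
move=> y; apply: (@continuous_comp _ _ _ (fun z : G => (z, x))
  (fun xy : G * G => (xy.1 * xy.2)%g)); last exact: mulg_continuous.
by apply: cvg_pair; [exact: cvg_id|exact: cvg_cst].
Qed.

Lemma left_coset_open (I : set G) (x : G) : open I -> open (left_coset I x).
Proof.
move=> oI; have /continuousP := @mulgl_continuous x^-1%g; exact.
Qed.

Lemma subgroup_open (S : set G) :
  subgroup_set S -> nbhs 1%g S -> open S.
Proof.
move=> [S1 SM SV] nS; rewrite openE => x Sx; rewrite /interior.
have := @mulgl_continuous x^-1%g x.
rewrite /continuous_at mulVg => /(_ S nS); rewrite /nbhs /=.
apply: filterS => y Sy.
by have := SM _ _ Sx Sy; rewrite mulVKg.
Qed.

Lemma open_subgroup_closed (S : set G) :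
  subgroup_set S -> open S -> closed S.
Proof.
move=> [S1 SM SV] oS; rewrite -openC.
rewrite openE => x Sx; rewrite /interior.
have : nbhs x (left_coset S x).
  by apply: open_nbhs_nbhs; split; [exact: left_coset_open|rewrite /left_coset/= mulVg].
apply: filterS => y /= Sy; apply: contra_not Sx => {}Sx.
have := SM _ _ Sx (SV _ Sy).
by rewrite invgM invgK mulVKg.
Qed.

Lemma compact_finite_cosets (I S : set G) :
  subgroup_set I -> open I -> compact S ->
  exists s : seq G, {in s, forall x, S x} /\
    forall y, S y -> exists2 x, x \in s & left_coset I x y.
Proof.
move=> [I1 IM IV] oI.
pose PG : ptopologicalType := HB.pack (Topological.sort G) (isPointed.Build (Topological.sort G) 1%g).
rewrite (compact_cover PG) => /(_ G S (left_coset I)) []; last first.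
- move=> D DS cD; exists (finmap.enum_fset D); split.
    by move=> x xD; have := DS x xD; rewrite inE.
  by move=> y /cD [x xD xy]; exists x.
- by move=> y Sy; exists y => //; rewrite /left_coset/= mulVg.
- by move=> x _; exact: left_coset_open.
Qed.
End TopGroupLemmas.

Section Image.
Context (k : fieldType) (G : topologicalGroupType) (V W : smooth_rep k G).
Context (f : rep_hom V W).

Definition imp : {pred W} := [pred w | `[< exists v, f v = w >]].
Lemma impP w : reflect (exists v, f v = w) (w \in imp).
Proof. by rewrite inE; exact: asboolP. Qed.

Fact imp_submod : GRing.submod_closed imp.
Proof.
split=> [|a x y /impP[v <-] /impP[w <-]]; apply/impP.
  by exists 0; exact: linear0.
by exists (a *: v + w); rewrite linearP.
Qed.
HB.instance Definition _ := GRing.isSubmodClosed.Build k W imp imp_submod.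

Definition im_sub := {w : W | w \in imp}.
HB.instance Definition _ := SubChoice.on im_sub.
HB.instance Definition _ := [SubChoice_isSubLmodule of im_sub by <:].

Definition im_in (w : W) (fw : exists v, f v = w) : im_sub :=
  exist (fun w => w \in imp) w (introT (impP w) fw).
Definition im_lval : {linear im_sub -> W} := val.
Lemma im_lval_inj : injective im_lval. Proof. exact: val_inj. Qed.
Lemma im_valP (w : im_sub) : exists v, f v = im_lval w.
Proof. exact/impP/(valP w). Qed.

Lemma im_act_subproof (g : G) (w : im_sub) : exists v, f v = act g (im_lval w).
Proof. by have [v <-] := im_valP w; exists (act g v); rewrite rhom_act. Qed.
Definition im_act g (w : im_sub) : im_sub := im_in (im_act_subproof g w).

Program Definition im_rep : smooth_rep k G :=
  @SmoothRep k G im_sub im_act _ _ _ _.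
Next Obligation. by move=> g a x y; apply: im_lval_inj; rewrite /= !linearP. Qed.
Next Obligation. by move=> v; apply: im_lval_inj; exact: act1. Qed.
Next Obligation. by move=> g h v; apply: im_lval_inj; exact: actM. Qed.
Next Obligation.
move=> w; have := act_smooth (im_lval w); congr open; apply/seteqP; split => g /=.
  by move=> E; exact: im_lval_inj.
by move/(congr1 im_lval).
Qed.
End Image.
Arguments im_lval {k G V W f}.
Arguments im_lval_inj {k G V W f}.

Section Boundaries.
Context (k : fieldType) (G : topologicalGroupType).
Implicit Types X Y : complex (Rep k G).

(* d_1 lands in X_(1 - 1), which is X_0 by computation. *)
Definition diff1 X : rep_hom (X 1) (X 0) := cdiff X 1.

Definition boundaries0 X : smooth_rep k G := im_rep (diff1 X).

Lemma boundaries0_subproof X Y (f : chain_map X Y) (x : boundaries0 X) :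
  exists y, diff1 Y y = (f 0 : rep_hom _ _) (im_lval x).
Proof.
have [v <-] := im_valP x; exists ((f 1 : rep_hom _ _) v).
exact: (congr1 (fun h : rep_hom _ _ => h v) (cmap_diff f 1)).
Qed.

Definition boundaries0_fun X Y (f : chain_map X Y) (x : boundaries0 X) :
  boundaries0 Y := im_in (boundaries0_subproof f x).

Fact boundaries0_linear X Y (f : chain_map X Y) : linear (boundaries0_fun f).
Proof. by move=> a x y; apply: im_lval_inj; rewrite /= !linearP. Qed.
HB.instance Definition _ X Y (f : chain_map X Y) :=
  GRing.isLinear.Build k (boundaries0 X) (boundaries0 Y) *:%R
    (boundaries0_fun f) (boundaries0_linear f).

Program Definition boundaries0_map X Y (f : chain_map X Y) :
    rep_hom (boundaries0 X) (boundaries0 Y) :=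
  @RepHom k G _ _ (boundaries0_fun f) _.
Next Obligation. by move=> *; apply: im_lval_inj; exact: rhom_act. Qed.

Program Definition B0 : functor (Ch (Rep k G)) (Rep k G) :=
  @Functor (Ch (Rep k G)) (Rep k G) boundaries0 boundaries0_map _ _.
Next Obligation. by move=> *; apply: rep_hom_eq => v; exact: im_lval_inj. Qed.
Next Obligation. by move=> *; apply: rep_hom_eq => v; exact: im_lval_inj. Qed.
End Boundaries.

Section Induction.
Context (k : fieldType) (p : nat) (G : topologicalGroupType).
Context (I : open_pro_p p G).

Definition support_set (f : G -> k^o) : set G := [set g | f g != 0].

Definition is_ind (f : G -> k^o) : Prop :=
  (forall g i, oset I i -> f (g * i)%g = f g) /\ compact (closure (support_set f)).

Definition indp : {pred G -> k^o} := [pred f | `[< is_ind f >]].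
Lemma indpP f : reflect (is_ind f) (f \in indp).
Proof. by rewrite inE; exact: asboolP. Qed.

Fact indp_submod : GRing.submod_closed indp.
Proof.
split=> [|a f f' /indpP[fI fc] /indpP[f'I f'c]]; apply/indpP; split.
- by [].
- rewrite (_ : support_set 0 = set0) ?closure0; first exact: compact0.
  by apply/seteqP; split=> // g /=; rewrite /support_set/= eqxx.
- by move=> g i Ii; rewrite /= !fctE fI// f'I.
apply: subclosed_compact (compactU fc f'c) _; first exact: closed_closure.
rewrite -closureU; apply: closure_subset => g; rewrite /support_set /= => fg.
apply: contrapT => /not_orP[/negP/negPn/eqP E /negP/negPn/eqP E'].
by move: fg; rewrite !fctE E E' scaler0 addr0 eqxx.
Qed.
HB.instance Definition _ := GRing.isSubmodClosed.Build k (G -> k^o) indp indp_submod.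

Definition ind_sub := {f : G -> k^o | f \in indp}.
HB.instance Definition _ := SubChoice.on ind_sub.
HB.instance Definition _ := [SubChoice_isSubLmodule of ind_sub by <:].

Definition ind_in (f : G -> k^o) (fP : is_ind f) : ind_sub :=
  exist (fun f => f \in indp) f (introT (indpP f) fP).
Definition ind_val : {linear ind_sub -> (G -> k^o)} := val.
Lemma ind_val_inj : injective ind_val. Proof. exact: val_inj. Qed.
Lemma ind_valP (f : ind_sub) : is_ind (ind_val f).
Proof. exact/indpP/(valP f). Qed.

Lemma ind_closed_supp (f : ind_sub) :
  closure (support_set (ind_val f)) = support_set (ind_val f).
Proof.
apply/esym/closure_id; rewrite -openC openE => g fg; rewrite /interior.
have : nbhs g (left_coset I g).
  apply: open_nbhs_nbhs; split; first exact/left_coset_open/oset_open.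
  by rewrite /left_coset /= mulVg; have [] := oset_subgroup I.
apply: filterS => h; rewrite /left_coset/= => Ih; have [fI _] := ind_valP f.
by have := fI g _ Ih; rewrite mulVKg /support_set/= => ->.
Qed.

Lemma ind_act_subproof (g : G) (f : ind_sub) :
  is_ind (fun h => ind_val f (g^-1 * h)%g).
Proof.
have [fI fc] := ind_valP f; split=> [h i Ii|]; first by rewrite mulgA fI.
pose S := support_set (ind_val f).
rewrite (_ : support_set _ = (fun h => (g^-1 * h)%g) @^-1` S)//.
rewrite -(closure_id _).1; last first.
  apply: closed_comp; last by rewrite /S -ind_closed_supp; exact: closed_closure.
  by move=> ? _; exact: mulgl_continuous.
rewrite (_ : _ @^-1` _ = (fun h => (g * h)%g) @` S).
  apply: continuous_compact; last by rewrite /S -ind_closed_supp.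
  by apply: continuous_subspaceT => x; exact: mulgl_continuous.
apply/seteqP; split=> [h /= Sh|h [h' Sh' <-]]; last by rewrite /= mulKg.
by exists (g^-1 * h)%g => //; rewrite mulVKg.
Qed.
Definition ind_act g f : ind_sub := ind_in (ind_act_subproof g f).

Lemma ind_act1 f : ind_act 1%g f = f.
Proof. by apply: ind_val_inj; apply: funext => h; rewrite /= invg1 mul1g. Qed.
Lemma ind_actM g h f : ind_act (g * h)%g f = ind_act g (ind_act h f).
Proof. by apply: ind_val_inj; apply: funext => x; rewrite /= invgM mulgA. Qed.

Lemma ind_smooth f : open [set g | ind_act g f = f].
Proof.
apply: subgroup_open.
  split=> [|g h /= gf hf|g /= gf]; first exact: ind_act1.
    by rewrite ind_actM hf.
  by rewrite -{1}gf -ind_actM mulVg ind_act1.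
have [fI _] := ind_valP f; have [I1 IM IV] := oset_subgroup I.
have [s [sS cov]] := compact_finite_cosets (oset_subgroup I) (oset_open I)
  (let: conj _ c := ind_valP f in c).
have : nbhs 1%g [set u : G | forall x, x \in s -> oset I (x^-1 * u * x)%g].
  elim: s {sS cov} => [|x s IH].
    by apply: filterS filterT => u _ x; rewrite in_nil.
  have : nbhs 1%g [set u : G | oset I (x^-1 * u * x)%g].
    apply: open_nbhs_nbhs; split; last by rewrite /= mulg1 mulVg.
    have /continuousP opl := @mulgl_continuous G x^-1%g.
    have /continuousP opr := @mulgr_continuous G x.
    exact: (opl _ (opr _ (oset_open I))).
  move=> nx; apply: filterS (filterI nx IH) => u [ux us] y.
  by rewrite inE => /predU1P[->|/us].
apply: filterS => u us /=; apply: ind_val_inj; apply: funext => h.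
change (ind_val f (u^-1 * h)%g = ind_val f h).
have key v : (forall x, x \in s -> oset I (x^-1 * v * x)%g) ->
    forall h, ind_val f h != 0 -> ind_val f (v * h)%g = ind_val f h.
  move=> vs h' /= h'0.
  have [x xs xh] : exists2 x, x \in s & left_coset I x h'.
    by apply: cov; rewrite ind_closed_supp.
  have := fI x _ (IM _ _ (vs x xs) xh).
  have -> : (x * (x^-1 * v * x * (x^-1 * h')) = v * h')%g.
    by rewrite -!mulgA mulVKg mulVKg.
  by move=> E; apply: (etrans E); have /esym := fI x _ xh; rewrite mulVKg.
have vs x : x \in s -> oset I (x^-1 * u^-1 * x)%g.
  move=> xs; have := IV _ (us x xs).
  by rewrite !invgM invgK mulgA.
have [f0|] := eqVneq (ind_val f h) 0; last exact: key.
apply/eqP; rewrite f0; apply: contrapT => /negP fh.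
by have := key _ us _ fh; rewrite mulVKg f0 => /esym/eqP; exact/negP.
Qed.

Fact ind_act_linear g : linear (ind_act g).
Proof. by move=> a x y; apply: ind_val_inj; apply: funext => h. Qed.

Definition ind_rep : smooth_rep k G :=
  @SmoothRep k G ind_sub ind_act ind_act_linear ind_act1 ind_actM ind_smooth.

End Induction.
Arguments ind_rep k {p G} I.
Arguments ind_val {k p G I}.
Arguments ind_val_inj {k p G I}.

Section EndomorphismRing.
Context (k : fieldType) (G : topologicalGroupType) (V : smooth_rep k G).

Definition rep_end := rep_hom V V.
HB.instance Definition _ := gen_eqMixin rep_end.
HB.instance Definition _ := gen_choiceMixin rep_end.
Implicit Types f g : rep_end.

Program Definition rend_add f g : rep_end :=
  @RepHom k G V V (f \+ g) _.
Next Obligation. by move=> * /=; rewrite !rhom_act linearD. Qed.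
Program Definition rend_opp f : rep_end :=
  @RepHom k G V V (\- f) _.
Next Obligation. by move=> * /=; rewrite !rhom_act linearN. Qed.

Fact rend_addA : associative rend_add.
Proof. by move=> f g h; apply: rep_hom_eq => v /=; rewrite addrA. Qed.
Fact rend_addC : commutative rend_add.
Proof. by move=> f g; apply: rep_hom_eq => v /=; rewrite addrC. Qed.
Fact rend_add0 : left_id (rhom_zero V V) rend_add.
Proof. by move=> f; apply: rep_hom_eq => v /=; rewrite add0r. Qed.
Fact rend_addN : left_inverse (rhom_zero V V) rend_opp rend_add.
Proof. by move=> f; apply: rep_hom_eq => v /=; rewrite addNr. Qed.
HB.instance Definition _ :=
  GRing.isZmodule.Build rep_end rend_addA rend_addC rend_add0 rend_addN.

Definition rend_mul f g : rep_end := rhom_comp f g.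
Fact rend_mulA : associative rend_mul.
Proof. by move=> f g h; apply: rep_hom_eq. Qed.
Fact rend_mul1 : left_id (rhom_id V) rend_mul.
Proof. by move=> f; apply: rep_hom_eq. Qed.
Fact rend_mulr1 : right_id (rhom_id V) rend_mul.
Proof. by move=> f; apply: rep_hom_eq. Qed.
Fact rend_mulDl : left_distributive rend_mul +%R.
Proof. by move=> f g h; apply: rep_hom_eq. Qed.
Fact rend_mulDr : right_distributive rend_mul +%R.
Proof. by move=> f g h; apply: rep_hom_eq => v /=; rewrite linearD. Qed.
HB.instance Definition _ := GRing.Zmodule_isPzRing.Build rep_end
  rend_mulA rend_mul1 rend_mulr1 rend_mulDl rend_mulDr.
End EndomorphismRing.

(* H = End_G(X)^op; it acts on X on the right by x h := h x. *)
Definition hecke (k : fieldType) (p : nat) (G : topologicalGroupType)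
  (I : open_pro_p p G) : pzRingType := (rep_end (ind_rep k I))^c.
Arguments hecke k {p G} I.

Section Frobenius.
Context (k : fieldType) (p : nat) (G : topologicalGroupType).
Context (I : open_pro_p p G).
Local Notation X := (ind_rep k I).

Fact ind_one_subproof :
  is_ind I (fun g : G => if `[< oset I g >] then 1 else 0 : k^o).
Proof.
have [I1 IM IV] := oset_subgroup I; split=> [g i Ii|].
  congr (if _ then _ else _); apply: asbool_equiv_eq; split=> [|Ig]; last exact: IM.
  by move=> /IM/(_ (IV _ Ii)); rewrite mulgK.
rewrite (_ : support_set _ = oset I); last first.
  apply/seteqP; split=> g; rewrite /support_set /=; case: asboolP => //.
    by rewrite eqxx.
  by move=> _ _; exact: oner_neq0.
rewrite -(closure_id _).1; first by have [] := oset_pro_p I.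
by apply: open_subgroup_closed; [exact: oset_subgroup|exact: oset_open].
Qed.

Definition ind_one : X := ind_in ind_one_subproof.

Definition coset_rep (g : G) : G := xget 1%g (left_coset I g).
Definition coset_reps : set G := [set t | coset_rep t = t].

Lemma left_coset_eq g h : left_coset I g h -> left_coset I g = left_coset I h.
Proof.
have [I1 IM IV] := oset_subgroup I; rewrite /left_coset /= => gh.
apply/seteqP; split=> x /= gx.
  by have := IM _ _ (IV _ gh) gx; rewrite invgM invgK -!mulgA mulVKg.
by have := IM _ _ gh gx; rewrite -!mulgA mulVKg.
Qed.

Lemma coset_repP g : left_coset I g (coset_rep g).
Proof.
apply: (@xgetPex _ 1%g (left_coset I g)); exists g.
by rewrite /left_coset/= mulVg; have [] := oset_subgroup I.
Qed.

Lemma coset_rep_eq g h : left_coset I g h -> coset_rep h = coset_rep g.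
Proof. by move=> /left_coset_eq gh; rewrite /coset_rep gh. Qed.

Lemma coset_repK g : coset_reps (coset_rep g).
Proof. exact/coset_rep_eq/coset_repP. Qed.

Lemma ind_coset (f : X) g h : left_coset I g h -> ind_val f h = ind_val f g.
Proof. by have [fI _] := ind_valP f; move=> /(fI g); rewrite mulVKg. Qed.

Definition reps_of (f : X) (r : seq G) : Prop :=
  [/\ uniq r, [set` r] `<=` coset_reps &
      forall t, coset_reps t -> t \notin r -> ind_val f t = 0].

Lemma reps_of_ex (f : X) : exists r, reps_of f r.
Proof.
have [s [_ cov]] := compact_finite_cosets (oset_subgroup I) (oset_open I)
  (let: conj _ c := ind_valP f in c).
exists (undup (map coset_rep s)); split; first exact: undup_uniq.
  by move=> t /=; rewrite mem_undup => /mapP[x _ ->]; exact: coset_repK.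
move=> t tT; rewrite mem_undup => tr; apply: contrapT => /eqP ft.
have [|x xs xt] := cov t; first by rewrite ind_closed_supp.
by move/negP: tr; apply; apply/mapP; exists x => //; rewrite -(coset_rep_eq xt).
Qed.

Lemma reps_of_common (f f' : X) : exists r, reps_of f r /\ reps_of f' r.
Proof.
have [r [_ rT fr]] := reps_of_ex f; have [r' [_ rT' fr']] := reps_of_ex f'.
have u : uniq (undup (r ++ r')) by exact: undup_uniq.
have sT : [set` undup (r ++ r')] `<=` coset_reps.
  by move=> t /=; rewrite mem_undup mem_cat => /orP[/rT|/rT'].
exists (undup (r ++ r')); split; split=> // t tT;
  rewrite mem_undup mem_cat negb_or => /andP[tr tr']; [exact: fr|exact: fr'].
Qed.

Lemma ind_gen (f : X) r : reps_of f r ->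
  f = \sum_(t <- r) ind_val f t *: act t ind_one.
Proof.
move=> [ru rT fr]; apply: ind_val_inj; apply: funext => h.
rewrite linear_sum fct_sumE.
have E t : t \in r -> ind_val (ind_val f t *: act t ind_one) h =
    if t == coset_rep h then ind_val f h else 0.
  move=> tr; rewrite linearZ /= !fctE.
  have tT : coset_rep t = t by exact: rT.
  case: asboolP => [th|th].
    rewrite -tT (coset_rep_eq th) eqxx; apply: etrans (mulr1 _) _.
    by rewrite tT; exact/esym/(ind_coset f th).
  rewrite scaler0; case: eqP => // tE; exfalso; apply: th.
  by have := coset_repP h; rewrite -tE => /left_coset_eq E;
    have : left_coset I h h by [rewrite /left_coset/= mulVg; have [] := oset_subgroup I];
    rewrite E.
rewrite (eq_big_seq _ E); have [cr|cr] := boolP (coset_rep h \in r).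
  rewrite (bigD1_seq (coset_rep h)) //= eqxx big1 ?addr0// => t.
  by move=> /negPf ->.
rewrite big1_seq => [|t /andP[_ tr]].
  have := fr _ (coset_repK h) cr.
  by rewrite (ind_coset f (coset_repP h)).
by case: eqP => // tE; rewrite tE (negPf cr) in tr.
Qed.

End Frobenius.
Section FrobeniusReciprocity.
Context (k : fieldType) (p : nat) (G : topologicalGroupType).
Context (I : open_pro_p p G).
Local Notation X := (ind_rep k I).
Implicit Types V W : smooth_rep k G.

Definition I_fixed V (v : V) : Prop := forall i, oset I i -> act i v = v.

(* For v in V^I, the G-map X -> V sending 1_I to v. *)
Definition frob_fun V (v : V) (f : X) : V :=
  \sum_(t \in coset_reps I) (ind_val f t : k) *: act t v.

Lemma frob_funE V (v : V) f r : reps_of f r ->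
  frob_fun v f = \sum_(t <- r) (ind_val f t : k) *: act t v.
Proof.
move=> [ru rT fr]; rewrite /frob_fun (fsbigE r) //.
  by rewrite big_seq_cond [RHS]big_seq_cond; apply: eq_bigl => t;
     case: (boolP (t \in r)) => //= tr; apply/mem_set/rT.
by move=> t tT tr; rewrite fr// scale0r.
Qed.

Lemma frob_linear V (v : V) : linear (frob_fun v).
Proof.
move=> a f f'.
have [r [rf rf']] := reps_of_common f f'.
have rff' : reps_of (a *: f + f') r.
  have [ru rT fr] := rf; have [_ _ fr'] := rf'; split=> // t tT tr.
  by rewrite linearP !fctE fr// fr'// scaler0 addr0.
rewrite (frob_funE _ rf) (frob_funE _ rf') (frob_funE _ rff').
rewrite scaler_sumr -big_split; apply: eq_bigr => t _ /=.
by rewrite scalerA -scalerDl.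
Qed.
HB.instance Definition _ V (v : V) :=
  GRing.isLinear.Build k X V *:%R (frob_fun v) (frob_linear v).

Lemma act_coset V (v : V) g h : I_fixed v -> left_coset I g h ->
  act h v = act g v.
Proof. by move=> vI gh; rewrite -[in RHS](vI _ gh) -actM mulVKg. Qed.

Lemma frob_act V (v : V) : I_fixed v ->
  forall g f, frob_fun v (act g f) = act g (frob_fun v f).
Proof.
move=> vI g f; have [r rf] := reps_of_ex f.
have [ru rT fr] := rf.
rewrite (frob_funE _ rf) linear_sum /=.
have gK h t : coset_reps I t -> coset_rep I (h^-1 * coset_rep I (h * t))%g = t.
  move=> tT; rewrite -[RHS]tT; apply: coset_rep_eq.
  have := coset_repP I (h * t)%g.
  by rewrite /left_coset /= invgM -!mulgA.
rewrite /frob_fun (@reindex_fsbig _ _ _ _ _ (fun t => coset_rep I (g * t)%g)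
   (coset_reps I)); last first.
  split=> [t _|t t' /set_mem tT /set_mem t'T tt'|t tT]; first exact: coset_repK.
    by rewrite -(gK g t tT) tt' gK.
  exists (coset_rep I (g^-1 * t)%g); first exact: coset_repK.
  by have := gK g^-1%g t tT; rewrite invgK.
have E t : (ind_val (act g f) (coset_rep I (g * t)%g) : k) *: act (coset_rep I (g * t)%g) v
    = (ind_val f t : k) *: act g (act t v).
  have gt := coset_repP I (g * t)%g.
  rewrite (act_coset vI gt) actM (ind_coset _ gt); congr (_ *: _).
  by change (ind_val f (g^-1 * (g * t))%g = ind_val f t); rewrite mulKg.
under eq_fsbigr do rewrite E.
rewrite (fsbigE r) //.
  rewrite big_seq_cond [RHS]big_seq; apply: congr_big => // t.
    by case: (boolP (t \in r)) => //= tr; apply/mem_set/rT.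
  by rewrite linearZ.
by move=> t tT tr; rewrite fr// scale0r.
Qed.

Definition frob V (v : V) (vI : I_fixed v) : rep_hom X V :=
  @RepHom k G X V (frob_fun v) (frob_act vI).

Lemma frob_one V (v : V) : I_fixed v -> frob_fun v (ind_one k I) = v.
Proof.
move=> vI; have [I1 IM IV] := oset_subgroup I.
have one1 g : oset I g -> (ind_val (ind_one k I) g : k) = 1.
  by move=> Ig; change ((if `[< oset I g >] then 1 else 0 : k) = 1); case: asboolP.
have one0 g : ~ oset I g -> (ind_val (ind_one k I) g : k) = 0.
  by move=> Ig; change ((if `[< oset I g >] then 1 else 0 : k) = 0); case: asboolP.
have c1 : oset I (coset_rep I 1%g).
  by have := coset_repP I 1%g; rewrite /left_coset/= invg1 mul1g.
rewrite (@frob_funE _ _ _ [:: coset_rep I 1%g]).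
  by rewrite big_seq1 one1// scale1r vI.
split=> //.
  by move=> t /=; rewrite inE => /eqP ->; exact: coset_repK.
move=> t tT; rewrite inE => /eqP t1; apply: one0 => It; apply: t1.
by rewrite -tT; apply: coset_rep_eq; rewrite /left_coset/= invg1 mul1g.
Qed.

Lemma ind_one_fixed : @I_fixed X (ind_one k I).
Proof.
move=> i Ii; have [I1 IM IV] := oset_subgroup I.
apply: ind_val_inj; apply: funext => h.
change ((if `[< oset I (i^-1 * h)%g >] then 1 else 0 : k) =
  (if `[< oset I h >] then 1 else 0)).
congr (if _ then _ else _); apply: asbool_equiv_eq; split=> Ih.
  by have := IM _ _ Ii Ih; rewrite mulVKg.
by apply: IM => //; exact: IV.
Qed.

Lemma hom_fixed V W (f : rep_hom V W) v : I_fixed v -> I_fixed (f v).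
Proof. by move=> vI i Ii; rewrite -rhom_act vI. Qed.

Lemma frob_uniq V (f : rep_hom X V) (x : X) :
  f x = frob_fun (f (ind_one k I)) x.
Proof.
have [r rx] := reps_of_ex x.
rewrite (frob_funE _ rx) {1}(ind_gen rx) linear_sum /=.
by apply: eq_bigr => t _; rewrite linearZ /= rhom_act.
Qed.

Section Invariants.
Context (V : smooth_rep k G).

Definition invp : {pred V} := [pred v | `[< I_fixed v >]].
Lemma invpP v : reflect (I_fixed v) (v \in invp).
Proof. by rewrite inE; exact: asboolP. Qed.

Fact invp_zmod : zmod_closed invp.
Proof.
split=> [|v w /invpP vI /invpP wI]; apply/invpP => i Ii; first exact: linear0.
by rewrite linearB /= vI// wI.
Qed.
HB.instance Definition _ := GRing.isZmodClosed.Build V invp invp_zmod.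

Definition inv_sub := {v : V | v \in invp}.
HB.instance Definition _ := SubChoice.on inv_sub.
HB.instance Definition _ := [SubChoice_isSubZmodule of inv_sub by <:].

Definition inv_in (v : V) (vI : I_fixed v) : inv_sub :=
  exist (fun v => v \in invp) v (introT (invpP v) vI).
Definition inv_val : {additive inv_sub -> V} := val.
Lemma inv_val_inj : injective inv_val. Proof. exact: val_inj. Qed.
Lemma inv_valP (v : inv_sub) : I_fixed (inv_val v).
Proof. exact/invpP/(valP v). Qed.

(* The left H-module structure of Hom_G(X, V), (h phi)(x) = phi (x h),
   transported to V^I along phi |-> phi 1_I. *)
Definition hecke_act (h : hecke k I) (v : inv_sub) : inv_sub :=
  inv_in (hom_fixed (frob (inv_valP v))
    (hom_fixed (h : rep_hom X X) ind_one_fixed)).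

Lemma frob_hecke_act (h : hecke k I) (v : inv_sub) (x : X) :
  frob_fun (inv_val (hecke_act h v)) x =
  frob_fun (inv_val v) ((h : rep_hom X X) x).
Proof.
by have := frob_uniq (rhom_comp (frob (inv_valP v)) (h : rep_hom X X)) x.
Qed.

Lemma frob_funD (v w : V) x :
  frob_fun (v + w) x = frob_fun v x + frob_fun w x.
Proof.
have [r rx] := reps_of_ex x; rewrite !(frob_funE _ rx) -big_split /=.
by apply: eq_bigr => t _; rewrite linearD scalerDr.
Qed.

Fact hecke_actA (a b : hecke k I) v :
  hecke_act a (hecke_act b v) = hecke_act (a * b) v.
Proof. by apply: inv_val_inj; exact: frob_hecke_act. Qed.
Fact hecke_act1 : left_id 1 hecke_act.
Proof. by move=> v; apply: inv_val_inj; exact/frob_one/inv_valP. Qed.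
Fact hecke_actDr : right_distributive hecke_act +%R.
Proof. by move=> h v w; apply: inv_val_inj; exact: frob_funD. Qed.
Fact hecke_actDl v : {morph hecke_act^~ v : a b / a + b}.
Proof.
by move=> a b; apply: inv_val_inj; exact: (linearD (frob (inv_valP v))).
Qed.
HB.instance Definition _ := GRing.Zmodule_isLmodule.Build (hecke k I) inv_sub
  hecke_actA hecke_act1 hecke_actDr hecke_actDl.

Definition inv_mod : lmodType (hecke k I) := inv_sub.
End Invariants.
Arguments inv_val {V}.
Arguments inv_val_inj {V}.

Definition inv_fun V W (f : rep_hom V W) (v : inv_sub V) : inv_sub W :=
  inv_in (hom_fixed f (inv_valP v)).

Fact inv_fun_linear V W (f : rep_hom V W) : linear (inv_fun f).
Proof.
move=> h v w; apply: inv_val_inj.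
apply: (etrans (congr1 f (raddfD inv_val (h *: v) w))).
apply: (etrans _ (esym (raddfD inv_val (h *: inv_fun f v) (inv_fun f w)))).
rewrite linearD; congr (_ + _).
have := frob_uniq (rhom_comp f (frob (inv_valP v)))
  ((h : rep_hom X X) (ind_one k I)).
by rewrite /= frob_one //; exact: inv_valP.
Qed.
HB.instance Definition _ V W (f : rep_hom V W) :=
  GRing.isLinear.Build (hecke k I) (inv_sub V) (inv_sub W) *:%R (inv_fun f)
    (inv_fun_linear f).

Definition inv_map V W (f : rep_hom V W) : {linear inv_mod V -> inv_mod W} :=
  inv_fun f.

Program Definition functorU : functor (Rep k G) (Mod (hecke k I)) :=
  @Functor (Rep k G) (Mod (hecke k I)) inv_mod inv_map _ _.
Next Obligation. by move=> *; apply: linear_eq => v; exact: inv_val_inj. Qed.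
Next Obligation. by move=> *; apply: linear_eq => v; exact: inv_val_inj. Qed.
End FrobeniusReciprocity.
Arguments functorU k {p G} I.

Section Tensor.
Context (k : fieldType) (p : nat) (G : topologicalGroupType).
Context (I : open_pro_p p G) (M : lmodType (hecke k I)).
Local Notation X := (ind_rep k I).

(* A list [:: (x_1, m_1); ...; (x_n, m_n)] stands for the formal sum of the
   x_i \otimes m_i; the tensor product is the quotient by the least congruence
   making concatenation commutative and \otimes biadditive and H-balanced. *)
Definition formal : Type := seq (X * M).
HB.instance Definition _ := Choice.on formal.
Implicit Types s t u : formal.

Inductive ten_eq : formal -> formal -> Prop :=
| TenRefl s : ten_eq s s
| TenSym s t : ten_eq s t -> ten_eq t s
| TenTrans s t u : ten_eq s t -> ten_eq t u -> ten_eq s u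
| TenCat s s' t t' : ten_eq s s' -> ten_eq t t' -> ten_eq (s ++ t) (s' ++ t')
| TenComm s t : ten_eq (s ++ t) (t ++ s)
| TenZero m : ten_eq [:: (0, m)] [::]
| TenAddl x y m : ten_eq [:: (x + y, m)] [:: (x, m); (y, m)]
| TenAddr x m n : ten_eq [:: (x, m + n)] [:: (x, m); (x, n)]
| TenBalanced x (h : hecke k I) m :
    ten_eq [:: ((h : rep_hom X X) x, m)] [:: (x, h *: m)].

Lemma ten_swap s t u : ten_eq (s ++ (t ++ u)) (t ++ (s ++ u)).
Proof.
by rewrite !catA; apply: TenCat; [exact: TenComm|exact: TenRefl].
Qed.

Definition ten_eqb : rel formal := fun s t => `[< ten_eq s t >].
Fact ten_eqb_refl : reflexive ten_eqb.
Proof. by move=> s; apply/asboolP; exact: TenRefl. Qed.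
Fact ten_eqb_sym : symmetric ten_eqb.
Proof. by move=> s t; apply/asboolP/asboolP; exact: TenSym. Qed.
Fact ten_eqb_trans : transitive ten_eqb.
Proof.
by move=> t s u /asboolP st /asboolP tu; apply/asboolP; exact: TenTrans tu.
Qed.
Canonical ten_equiv := EquivRel ten_eqb ten_eqb_refl ten_eqb_sym ten_eqb_trans.

Definition tensor : Type := {eq_quot ten_equiv}.
HB.instance Definition _ := Choice.on tensor.
HB.instance Definition _ := EqQuotient.on tensor.

Definition ten_sum (s : formal) : tensor := \pi_tensor s.
Definition pure_tensor (x : X) (m : M) : tensor := ten_sum [:: (x, m)].

Lemma ten_sumP s t : ten_sum s = ten_sum t <-> ten_eq s t.
Proof.
split=> [/eqP|st]; last by apply/eqP; rewrite eqquotE; exact/asboolP.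
by rewrite eqquotE => /asboolP.
Qed.

Lemma tensorW (P : tensor -> Prop) : (forall s, P (ten_sum s)) -> forall a, P a.
Proof. by move=> Ps; elim/quotW. Qed.

Lemma ten_repr a : ten_sum (repr a) = a. Proof. exact: reprK. Qed.

Lemma repr_ten s : ten_eq (repr (ten_sum s)) s.
Proof. exact/ten_sumP/ten_repr. Qed.

Definition ten_add (a b : tensor) : tensor := ten_sum (repr a ++ repr b).
Lemma ten_addE s t : ten_add (ten_sum s) (ten_sum t) = ten_sum (s ++ t).
Proof. by apply/ten_sumP/TenCat; exact: repr_ten. Qed.

Section Lift.
Context (f : X -> X) (f0 : f 0 = 0) (fD : {morph f : x y / x + y}).
Context (fH : forall (h : hecke k I) x,
  f ((h : rep_hom X X) x) = (h : rep_hom X X) (f x)).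

Definition ten_mapl_formal (s : formal) : formal := [seq (f z.1, z.2) | z <- s].

Lemma ten_mapl_eq s t : ten_eq s t ->
  ten_eq (ten_mapl_formal s) (ten_mapl_formal t).
Proof.
elim=> {s t} [s|s t _|s t u _ h1 _|s s' t t' _ h1 _ h2|s t|m|x y m|x m n|x h m].
- exact: TenRefl.
- exact: TenSym.
- exact: TenTrans.
- by rewrite /ten_mapl_formal !map_cat; exact: TenCat.
- by rewrite /ten_mapl_formal !map_cat; exact: TenComm.
- by rewrite /= f0; exact: TenZero.
- by rewrite /= fD; exact: TenAddl.
- exact: TenAddr.
- by rewrite /= fH; exact: TenBalanced.
Qed.
End Lift.

Definition ten_mapl (f : X -> X) (a : tensor) : tensor :=
  ten_sum (ten_mapl_formal f (repr a)).

Definition balanced (f : X -> X) : Prop :=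
  [/\ f 0 = 0, {morph f : x y / x + y} & forall (h : hecke k I) x,
    f ((h : rep_hom X X) x) = (h : rep_hom X X) (f x)].

Lemma ten_maplE f : balanced f -> forall s,
  ten_mapl f (ten_sum s) = ten_sum (ten_mapl_formal f s).
Proof. by move=> [f0 fD fH] s; apply/ten_sumP/ten_mapl_eq/repr_ten. Qed.

Lemma balanced_opp : balanced -%R.
Proof.
by split=> [|x y|h x]; [exact: oppr0|exact: opprD|rewrite linearN].
Qed.
Lemma balanced_scale a : balanced ( *:%R a).
Proof.
by split=> [|x y|h x]; [exact: scaler0|exact: scalerDr|rewrite linearZ].
Qed.
Lemma balanced_act g : balanced (@act k G X g).
Proof.
by split=> [|x y|h x]; [exact: linear0|exact: linearD|rewrite rhom_act].
Qed.

Fact ten_addA : associative ten_add.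
Proof.
by elim/tensorW=> s; elim/tensorW=> t; elim/tensorW=> u; rewrite !ten_addE catA.
Qed.
Fact ten_addC : commutative ten_add.
Proof.
by elim/tensorW=> s; elim/tensorW=> t; rewrite !ten_addE; exact/ten_sumP/TenComm.
Qed.
Fact ten_add0 : left_id (ten_sum [::]) ten_add.
Proof. by elim/tensorW=> s; rewrite ten_addE. Qed.
Fact ten_addN : left_inverse (ten_sum [::]) (ten_mapl -%R) ten_add.
Proof.
elim/tensorW=> s; rewrite (ten_maplE balanced_opp) ten_addE; apply/ten_sumP.
elim: s => [|[x m] s IH]; first exact: TenRefl.
have sw := @ten_swap (ten_mapl_formal -%R s) [:: (x, m)] s.
apply: TenTrans (TenCat (TenRefl [:: (- x, m)]) sw) _.
change (ten_eq ([:: (- x, m); (x, m)] ++ (ten_mapl_formal -%R s ++ s)) ([::] ++ [::])).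
apply: TenCat IH.
apply: TenTrans (TenSym (TenAddl _ _ _)) _.
by rewrite addNr; exact: TenZero.
Qed.
HB.instance Definition _ :=
  GRing.isZmodule.Build tensor ten_addA ten_addC ten_add0 ten_addN.

Lemma ten_sum_cat s t : ten_sum (s ++ t) = ten_sum s + ten_sum t.
Proof. by rewrite -ten_addE. Qed.

Lemma ten_maplD f : balanced f -> {morph ten_mapl f : a b / a + b}.
Proof.
move=> fP; elim/tensorW=> s; elim/tensorW=> t.
by rewrite -ten_sum_cat !(ten_maplE fP) /ten_mapl_formal map_cat ten_sum_cat.
Qed.

Lemma ten_mapl_comp f g : balanced f -> balanced g -> forall a,
  ten_mapl f (ten_mapl g a) = ten_mapl (f \o g) a.
Proof.
move=> fP gP; elim/tensorW=> s; have fgP : balanced (f \o g).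
  case: fP gP => [f0 fD fH] [g0 gD gH].
  by split=> [|x y|h x] /=; rewrite ?g0 ?f0 ?gD ?fD ?gH ?fH.
rewrite (ten_maplE gP) (ten_maplE fP) (ten_maplE fgP).
by rewrite /ten_mapl_formal -map_comp.
Qed.

Definition ten_scale (a : k) : tensor -> tensor := ten_mapl ( *:%R a).
Fact ten_scaleA a b v : ten_scale a (ten_scale b v) = ten_scale (a * b) v.
Proof.
rewrite /ten_scale ten_mapl_comp; try exact: balanced_scale.
by congr ten_mapl; apply: funext => x /=; rewrite scalerA.
Qed.
Fact ten_scale1 : left_id 1 ten_scale.
Proof.
elim/tensorW=> s; rewrite /ten_scale (ten_maplE (balanced_scale 1)).
by congr ten_sum; rewrite -[RHS]map_id; apply: eq_map => -[x m] /=; rewrite scale1r.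
Qed.
Fact ten_scaleDr : right_distributive ten_scale +%R.
Proof. by move=> a; exact/ten_maplD/balanced_scale. Qed.
Fact ten_scaleDl v : {morph ten_scale^~ v : a b / a + b}.
Proof.
move=> a b; elim/tensorW: v => s; rewrite /ten_scale.
rewrite !(ten_maplE (balanced_scale _)) -ten_sum_cat; apply/ten_sumP.
elim: s => [|[x m] s IH]; first exact: TenRefl.
rewrite /= scalerDl.
apply: TenTrans (TenCat (TenAddl _ _ _) IH) _ => /=.
have sw := ten_swap [:: (b *: x, m)] (ten_mapl_formal ( *:%R a) s)
  (ten_mapl_formal ( *:%R b) s).
exact: TenCat (TenRefl [:: (a *: x, m)]) sw.
Qed.
HB.instance Definition _ := GRing.Zmodule_isLmodule.Build k tensor
  ten_scaleA ten_scale1 ten_scaleDr ten_scaleDl.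

Definition ten_act (g : G) : tensor -> tensor := ten_mapl (act g).

Fact ten_act_linear g : linear (ten_act g).
Proof.
move=> a x y; rewrite /ten_act (ten_maplD (balanced_act g)); congr (_ + _).
rewrite [LHS]ten_mapl_comp; [|exact: balanced_act|exact: balanced_scale].
rewrite [RHS]ten_mapl_comp; [|exact: balanced_scale|exact: balanced_act].
by congr ten_mapl; apply: funext => z; exact: (linearZ_LR (@act k G X g)).
Qed.
Fact ten_act1 v : ten_act 1%g v = v.
Proof.
elim/tensorW: v => s; rewrite /ten_act (ten_maplE (balanced_act _)).
by congr ten_sum; rewrite -[RHS]map_id; apply: eq_map => -[x m]; rewrite act1.
Qed.
Fact ten_actM g h v : ten_act (g * h)%g v = ten_act g (ten_act h v).
Proof.
rewrite /ten_act ten_mapl_comp; try exact: balanced_act.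
by congr ten_mapl; apply: funext => x; exact: actM.
Qed.
Fact ten_act_smooth v : open [set g | ten_act g v = v].
Proof.
apply: subgroup_open.
  split=> [|g h /= gv hv|g /= gv]; first exact: ten_act1.
    by rewrite ten_actM hv.
  by rewrite -{1}gv -ten_actM mulVg ten_act1.
elim/tensorW: v => s; elim: s => [|[x m] s IH].
  by apply: filterS filterT => g _; rewrite /= /ten_act (ten_maplE (balanced_act _)).
have xo : nbhs 1%g [set g : G | act g x = x].
  by apply: open_nbhs_nbhs; split; [exact: act_smooth|exact: act1].
apply: filterS (filterI xo IH) => g [/= gx gs].
rewrite -cat1s ten_sum_cat /= /ten_act (ten_maplD (balanced_act g)).
congr (_ + _); last exact: gs.
by rewrite (ten_maplE (balanced_act g)); congr ten_sum; rewrite /= gx.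
Qed.

Definition ind_tensor : smooth_rep k G := @SmoothRep k G tensor ten_act
  ten_act_linear ten_act1 ten_actM ten_act_smooth.
End Tensor.
Arguments ind_tensor {k p G I} M.
Arguments ten_sum {k p G I M} s.
Arguments pure_tensor {k p G I M} x m.

Section TensorFunctor.
Context (k : fieldType) (p : nat) (G : topologicalGroupType).
Context (I : open_pro_p p G).
Implicit Types L M N : lmodType (hecke k I).

Definition ten_mapr_formal M N (f : M -> N) (s : formal M) : formal N :=
  [seq (z.1, f z.2) | z <- s].

Lemma ten_mapr_eq M N (f : {linear M -> N}) s t : ten_eq s t ->
  ten_eq (ten_mapr_formal f s) (ten_mapr_formal f t).
Proof.
elim=> {s t} [s|s t _|s t u _ h1 _|s s' t t' _ h1 _ h2|s t|m|x y m|x m n|x h m].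
- exact: TenRefl.
- exact: TenSym.
- exact: TenTrans.
- by rewrite /ten_mapr_formal !map_cat; exact: TenCat.
- by rewrite /ten_mapr_formal !map_cat; exact: TenComm.
- exact: TenZero.
- exact: TenAddl.
- by rewrite /= linearD; exact: TenAddr.
- by rewrite /= linearZ; exact: TenBalanced.
Qed.

Definition ten_mapr M N (f : {linear M -> N}) (a : tensor M) : tensor N :=
  ten_sum (ten_mapr_formal f (repr a)).

Lemma ten_maprE M N (f : {linear M -> N}) s :
  ten_mapr f (ten_sum s) = ten_sum (ten_mapr_formal f s).
Proof. exact/ten_sumP/ten_mapr_eq/repr_ten. Qed.

Fact ten_mapr_linear M N (f : {linear M -> N}) : linear (ten_mapr f).
Proof.
move=> a; elim/tensorW=> s; elim/tensorW=> t.
have sE (L : lmodType (hecke k I)) (u : formal L) :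
    a *: ten_sum u = ten_sum (ten_mapl_formal ( *:%R a) u).
  exact/ten_maplE/balanced_scale.
rewrite sE -ten_sum_cat !ten_maprE sE -ten_sum_cat /ten_mapr_formal map_cat.
by rewrite /ten_mapl_formal -!map_comp.
Qed.
HB.instance Definition _ M N (f : {linear M -> N}) :=
  GRing.isLinear.Build k (tensor M) (tensor N) *:%R (ten_mapr f)
    (ten_mapr_linear f).

Fact ten_mapr_act M N (f : {linear M -> N}) g a :
  ten_mapr f (ten_act g a) = ten_act g (ten_mapr f a).
Proof.
elim/tensorW: a => s; rewrite /ten_act (ten_maplE (balanced_act _ _ _)) !ten_maprE.
rewrite (ten_maplE (balanced_act _ _ _)).
by rewrite /ten_mapl_formal /ten_mapr_formal -!map_comp.
Qed.

Definition ind_tensor_map M N (f : {linear M -> N}) :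
    rep_hom (ind_tensor M) (ind_tensor N) :=
  @RepHom k G (ind_tensor M) (ind_tensor N) (ten_mapr f) (ten_mapr_act f).

Program Definition functorF : functor (Mod (hecke k I)) (Rep k G) :=
  @Functor (Mod (hecke k I)) (Rep k G) ind_tensor ind_tensor_map _ _.
Next Obligation.
move=> M; apply: rep_hom_eq; elim/tensorW=> s /=.
rewrite ten_maprE; congr ten_sum; rewrite -[RHS]map_id.
by apply: eq_map => -[].
Qed.
Next Obligation.
move=> L M N g f; apply: rep_hom_eq; elim/tensorW=> s /=.
by rewrite !ten_maprE /ten_mapr_formal -map_comp.
Qed.

Lemma functorF0 (M N : Mod (hecke k I)) : fmor functorF (zerom M N) = zerom (functorF M) (functorF N).
Proof.
apply: rep_hom_eq; elim/tensorW=> s /=; rewrite ten_maprE.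
elim: s => [//|[x m] s IH]; rewrite /ten_mapr_formal /= -cat1s ten_sum_cat IH.
rewrite addr0; apply/ten_sumP.
have z0 : ten_eq [:: (x, 0 : N)] ([:: (0, 0 : N)]).
  have := @TenBalanced k p G I N x 0 0.
  by rewrite scaler0 => /TenSym.
exact: TenTrans z0 (TenZero _).
Qed.
End TensorFunctor.
Arguments functorF k {p G} I.

Section IGorensteinProjective.
Context (k : fieldType) (p : nat) (G : topologicalGroupType).
Context (I : open_pro_p p G).

Definition direct_summand (V W : smooth_rep k G) : Prop :=
  exists (V' : smooth_rep k G) (i : rep_hom V W) (j : rep_hom V' W),
    bijective (fun vv : V * V' => i vv.1 + j vv.2).

Definition I_projective (V : smooth_rep k G) : Prop :=
  exists P : Mod (hecke k I), projective_module P /\ direct_summand V (functorF k I P).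

Definition I_exact (V1 V2 V3 : Rep k G) (f : mor V1 V2) (g : mor V2 V3) : Prop :=
  g \oc f = zerom V1 V3 /\ exact_at (fmor (functorU k I) f) (fmor (functorU k I) g).

Definition I_exact_complex (X : complex (Rep k G)) : Prop :=
  forall n : int, I_exact (cdiff X n) (cdiff X (n - 1)).

Definition I_gorenstein_projective (V : Rep k G) : Prop :=
  exists X : complex (Rep k G),
    [/\ forall n, I_projective (X n), I_exact_complex X & iso V (B0 k G X)].

Definition functorF_ch : functor (Ch (Mod (hecke k I))) (Ch (Rep k G)) :=
  termwise (@functorF0 k p G I).

Definition functorFF (Y : gproj_resolution (hecke k I)) :
  functor (Mod (hecke k I)) (Rep k G) := B0 k G \of (functorF_ch \of Y).
End IGorensteinProjective.
Arguments I_gorenstein_projective {k p G} I V.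
Arguments functorFF {k p G I} Y.

(* Main.v *)
From HB Require Import structures.
From mathcomp Require Import all_boot all_order all_algebra.
From mathcomp Require Import boolp classical_sets functions fsbigop.
Require Import Defs.

(** The functor F is left adjoint to U, so the theorem comes down to two facts
    about the unit and the counit, and one fact about complexes over H.

    The unit P -> U F P, m |-> 1_I \otimes m, is bijective when P is projective
    ([unit_injective], [unit_surjective]): for P = H it is the identification of
    H = End_G(X) with X^I, and a dual basis of P reduces every computation in
    X \otimes_H P to finitely many copies of that case.  Taking retracts, UV is
    projective and the counit F U V -> V is bijective for every I-projective V.
    So U and F are inverse to each other between I-projective representations
    and projective modules; U turns an I-exact complex of I-projectives into an
    acyclic complex of projectives, and F does the converse.

    Over a Gorenstein ring, every acyclic complex of projectives stays exact
    under Hom(-, P) for P projective ([projective_hom_exact]).  Indeed P is a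
    retract of a free module, a free module has finite injective dimension
    because over a left noetherian ring direct sums of injectives are injective
    (Baer's criterion), and exactness of Hom(-, M) passes from injective M to M
    of finite injective dimension by dimension shifting.  Hence if V = B_0 X for
    an I-exact complex X of I-projectives, then UV = Z_0 (UX) is Gorenstein
    projective.

    Let M be Gorenstein projective and Y its resolution.  As the unit is
    bijective on the terms of Y, it identifies Z_0 Y = M with U(B_0 FY)
    ([unit_cycle]).  Conversely, let V be I-Gorenstein projective, Y the
    resolution of UV, and pi : Y_1 -> Z_0 Y = UV.  The map
    FY_1 -> F U V -> V has the same kernel as F(d_1) : FY_1 -> FY_0 and is onto,
    so it induces an isomorphism from B_0 FY to V ([boundaries_counit]).  To
    compare the kernels, choose a complex X with V = B_0 X.  Exactness of
    Hom(Y, UX_0) and of Hom(UX, Y_0) extends the identity of UV to maps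
    Y_0 -> UX_0 and UX_0 -> Y_0, and F U X_0 = X_0.  Both isomorphisms are
    given by formulas natural in M and V. *)

Set Implicit Arguments.
Unset Strict Implicit.
Unset Printing Implicit Defensive.

Import GRing.Theory.
Local Open Scope classical_set_scope.
Local Open Scope ring_scope.

(** * Baer's criterion *)

Section LinearMaps.
Context (R : pzRingType).
Implicit Types M N E : lmodType R.

Definition mk_linear M N (f : M -> N) (fL : linear f) : {linear M -> N} :=
  HB.pack f (GRing.isLinear.Build R M N *:%R f fL).

(** Most linear maps below are only determined by a property of their values
    (a lift, a factorization, an inverse); this builds them from that
    property. *)
Lemma linear_choice M N (S : M -> N -> Prop) :
  (forall m, exists n, S m n) -> (forall m n n', S m n -> S m n' -> n = n') ->
  (forall a m m' n n', S m n -> S m' n' -> S (a *: m + m') (a *: n + n')) ->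
  exists g : {linear M -> N}, forall m, S m (g m).
Proof.
move=> ex uniqS lin; have /boolp.choice[g gP] := ex.
have gL : linear g.
  by move=> a x y; apply: uniqS (gP _) _; exact: lin.
by exists (mk_linear gL).
Qed.

Section Baer.
Context (E : lmodType R).

Definition baer_criterion : Prop :=
  forall (J : set R) (phi : R -> E), left_ideal J ->
    (forall x y, J x -> J y -> phi (x + y) = phi x + phi y) ->
    (forall a x, J x -> phi (a * x) = a *: phi x) ->
    exists e, forall x, J x -> phi x = x *: e.

Context (M N : lmodType R) (i : {linear M -> N}) (f : {linear M -> E}).

(** A linear map defined on a submodule of N and extending f along i, encoded by
    its graph: graphs are ordered by inclusion, which suits Zorn's lemma. *)
Definition partial_extension (S : set (N * E)) : Prop :=
  [/\ forall m, S (i m, f m),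
      forall a u v, S u -> S v -> S (a *: u + v) &
      forall e, S (0, e) -> e = 0].

Lemma partial_extension_graph : injective i ->
  partial_extension [set (i m, f m) | m in [set: M]].
Proof.
move=> i_inj; split=> [m|a _ _ [m _ <-] [m' _ <-]|e [m _ []]].
- by exists m.
- by exists (a *: m + m') => //; rewrite !linearP.
- rewrite -(linear0 i) => /i_inj -> <-; exact: linear0.
Qed.

(** The empty set is admitted in the use of Zorn's lemma because it is the union
    of the empty chain; a maximal element is then a genuine extension. *)
Lemma maximal_partial_extension : injective i ->
  exists S, partial_extension S /\
    forall S', partial_extension S' -> S `<=` S' -> S' `<=` S.
Proof.
move=> i_inj.
have [|S [PS maxS]] :=
    @Zorn_bigcup _ (fun S => S = set0 \/ partial_extension S).
  move=> F FP totF.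
  have [[S0 FS0 PS0]|noF] := pselect (exists2 S, F S & partial_extension S).
    right; split=> [m|a u v [S FS Su] [T FT Tv]|e [S FS Se]].
    - by exists S0 => //; have [/(_ m)] := PS0.
    - have PT X w : F X -> X w -> partial_extension X.
        by move=> /FP[->|].
      have [ST|TS] := totF _ _ FS FT.
        exists T => //; have [_ + _] := PT _ _ FT Tv; apply=> //; exact: ST.
      by exists S => //; have [_ + _] := PT _ _ FS Su; apply=> //; exact: TS.
    - by have [E0|[_ _]] := FP _ FS; [rewrite E0 in Se|apply].
  left; apply/seteqP; split=> // u [S FS Su].
  by have [E0|PS] := FP _ FS; [rewrite E0 in Su|apply: noF; exists S].
have PG := partial_extension_graph i_inj.
have {PS}PS : partial_extension S.
  case: PS => // S0; exfalso; apply: (maxS _ _ (or_intror PG)).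
  rewrite S0; split=> //.
  move=> sub; suff /sub : [set (i m, f m) | m in [set: M]] (i 0, f 0) by [].
  by exists 0.
exists S; split=> // S' PS' SS'; apply: contrapT => S'S.
by apply: (maxS S' _ (or_intror PS')).
Qed.

(** The r with r n0 in the domain of S form a left ideal J, and r |-> S(r n0) is
    a linear map on J.  By the criterion it is r |-> r e0, so n0 |-> e0 is a
    consistent extension of S. *)
Lemma extend_one S (n0 : N) : baer_criterion -> partial_extension S ->
  exists S', [/\ partial_extension S', S `<=` S' & exists e, S' (n0, e)].
Proof.
move=> baer [SG SL S0].
have S00 : S (0, 0) by have := SG 0; rewrite !linear0.
have Sz a n e : S (n, e) -> S (a *: n, a *: e).
  by move=> /(SL a _ (0, 0))/(_ S00); rewrite addr0.
have Sa n n' e e' : S (n, e) -> S (n', e') -> S (n + n', e + e').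
  by move=> /(SL 1) H /H; rewrite scale1r.
have Su n e e' : S (n, e) -> S (n, e') -> e = e'.
  move=> Se /(Sz (-1)) Se'; have := Sa _ _ _ _ Se Se'.
  by rewrite !scaleN1r subrr => /S0/subr0_eq.
pose J := [set r : R | exists e, S (r *: n0, e)].
have /boolp.choice[phi phiP] (r : R) : exists e, J r -> S (r *: n0, e).
  by have [[e Se]|nJ] := pselect (J r); [exists e|exists 0].
have JI : left_ideal J.
  split=> [|x y [e Se] [e' Se']|a x [e Se]].
  - by exists 0; rewrite scale0r.
  - by exists (e + e'); rewrite scalerDl; exact: Sa.
  - by exists (a *: e); rewrite -scalerA; exact: Sz.
have [_ JD JM] := JI.
have [e0 e0P] : exists e0, forall x, J x -> phi x = x *: e0.
  apply: (baer J) => // [x y Jx Jy|a x Jx].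
    apply: Su (phiP _ (JD _ _ Jx Jy)) _.
    by rewrite scalerDl; apply: Sa; exact: phiP.
  apply: Su (phiP _ (JM a _ Jx)) _.
  by rewrite -scalerA; apply: Sz; exact: phiP.
(* The graph S + R (n0, e0). *)
exists [set u | exists r v, S v /\ u = v + (r *: n0, r *: e0)]; split.
- split=> [m|a _ _ [r [v [Sv ->]]] [r' [v' [Sv' ->]]]|e [r [[n e'] [Sv []]]]].
  + by exists 0, (i m, f m); rewrite !scale0r addr0.
  + exists (a * r + r'), (a *: v + v'); split; first exact: SL.
    rewrite scalerDr addrACA !scalerDl -!scalerA; congr (_ + _).
  + move=> /esym/eqP; rewrite addr_eq0 => /eqP nE ->.
    have Sr : S (r *: n0, - e').
      by have := Sz (-1) _ _ Sv; rewrite !scaleN1r nE opprK.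
    rewrite -e0P; last by exists (- e').
    by rewrite (Su _ _ _ (phiP r (ex_intro _ _ Sr)) Sr) subrr.
- by move=> u Su0; exists 0, u; rewrite !scale0r addr0.
- by exists e0, 1, (0, 0); rewrite !scale1r add0r.
Qed.

End Baer.

Lemma baer_injective E : baer_criterion E -> injective_module E.
Proof.
move=> baer M N i f /(maximal_partial_extension f)[S [PS maxS]].
have [SG SL S0] := PS.
have [n|n e e' Se Se'|a n n' e e' Se Se'|g gP] :=
    @linear_choice N E (fun n e => S (n, e)).
- have [S' [PS' SS' [e S'e]]] := extend_one n baer PS.
  by exists e; exact: (maxS _ PS').
- have := SL (-1) _ _ Se' Se; rewrite scaleN1r addrC => Sd.
  by apply/subr0_eq/S0; rewrite -(subrr n).
- exact: (SL a (n, e) (n', e')).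
exists g => m /=; have := SL (-1) _ _ (gP (i m)) (SG m).
rewrite scaleN1r addrC => Sd.
by apply/subr0_eq/S0; rewrite -(subrr (i m)).
Qed.

End LinearMaps.

(** * Direct sums of copies of a module *)

Section LinearImage.
Context (R : pzRingType) (A B : lmodType R) (d : {linear A -> B}).

Definition image_pred : {pred B} := [pred b | `[< exists a, d a = b >]].
Lemma image_predP b : reflect (exists a, d a = b) (b \in image_pred).
Proof. by rewrite inE; exact: asboolP. Qed.

Fact image_submod : GRing.submod_closed image_pred.
Proof.
split=> [|c x y /image_predP[a <-] /image_predP[a' <-]]; apply/image_predP.
  by exists 0; exact: linear0.
by exists (c *: a + a'); rewrite linearP.
Qed.
HB.instance Definition _ := GRing.isSubmodClosed.Build R B image_pred image_submod.

Definition image_sub := {b : B | b \in image_pred}.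
HB.instance Definition _ := SubChoice.on image_sub.
HB.instance Definition _ := [SubChoice_isSubLmodule of image_sub by <:].
Definition image_mod : lmodType R := image_sub.
Definition image_val : {linear image_mod -> B} := (val : image_sub -> B).
Definition image_in (a : A) : image_mod :=
  exist (fun b => b \in image_pred) (d a) (introT (image_predP _) (ex_intro _ a erefl)).
Lemma image_val_inj : injective image_val. Proof. exact: val_inj. Qed.
Lemma image_valP (b : image_mod) : exists a, d a = image_val b.
Proof. exact/image_predP/(valP b). Qed.

(** The map f factors through the submodule d(A) of B, from which it extends by
    injectivity. *)
Lemma injective_extend (E : lmodType R) (f : {linear A -> E}) :
  injective_module E -> (forall a, d a = 0 -> f a = 0) ->
  exists g : {linear B -> E}, forall a, g (d a) = f a.
Proof.
move=> injE kerf.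
have fE a a' : d a = d a' -> f a = f a'.
  move=> E0; apply/subr0_eq; rewrite -linearB; apply: kerf.
  by rewrite linearB E0 subrr.
have [b|b e e' [a [da <-]] [a' [da' <-]]|c b b' e e' [a [da <-]] [a' [da' <-]]|h hP] :=
  @linear_choice R image_mod E (fun b e => exists a, d a = image_val b /\ f a = e).
- by have [a da] := image_valP b; exists (f a), a.
- by apply: fE; rewrite da da'.
- by exists (c *: a + a'); rewrite !linearP da da'.
have [g gP] := injE _ _ image_val h image_val_inj.
exists g => a; have [a' [da' fa']] := hP (image_in a).
by have /esym := gP (image_in a); rewrite /= => ->; rewrite -fa'; apply: fE.
Qed.

End LinearImage.
Arguments image_val {R A B d}.

Section Copower.
Context (R : pzRingType) (K : choiceType).
Implicit Types E N : lmodType R.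

Definition fin_supp E (f : K -> E) : Prop :=
  exists s : seq K, forall j, j \notin s -> f j = 0.
Definition fin_supp_pred E : {pred K -> E} := [pred f | `[< fin_supp f >]].
Lemma fin_suppP E (f : K -> E) : reflect (fin_supp f) (f \in @fin_supp_pred E).
Proof. by rewrite inE; exact: asboolP. Qed.

Fact fin_supp_submod E : GRing.submod_closed (@fin_supp_pred E).
Proof.
split=> [|a f g /fin_suppP[s fs] /fin_suppP[t gt]]; apply/fin_suppP.
  by exists [::].
exists (s ++ t) => j; rewrite mem_cat negb_or => /andP[js jt].
by rewrite !fctE fs// gt// scaler0 addr0.
Qed.
HB.instance Definition _ E :=
  GRing.isSubmodClosed.Build R (K -> E) (@fin_supp_pred E) (@fin_supp_submod E).

Definition copower_sub E := {f : K -> E | f \in @fin_supp_pred E}.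
HB.instance Definition _ E := SubChoice.on (copower_sub E).
HB.instance Definition _ E := [SubChoice_isSubLmodule of copower_sub E by <:].
(** The direct sum of copies of E indexed by K. *)
Definition copower E : lmodType R := copower_sub E.
Definition component E : {linear copower E -> (K -> E)} :=
  (val : copower_sub E -> (K -> E)).
Definition mk_copower E (f : K -> E) (fs : fin_supp f) : copower E :=
  exist (fun f => f \in @fin_supp_pred E) f (introT (fin_suppP f) fs).
Lemma component_inj E : injective (@component E). Proof. exact: val_inj. Qed.
Lemma componentP E (f : copower E) : fin_supp (component E f).
Proof. exact/fin_suppP/(valP f). Qed.
Lemma component_mk E (f : K -> E) (fs : fin_supp f) :
  component E (mk_copower fs) = f.
Proof. by []. Qed.
Lemma copowerP E (f g : copower E) :
  (forall j, component E f j = component E g j) <-> f = g.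
Proof. by split=> [fg|->//]; apply/component_inj/funext. Qed.

Lemma copower_common_supp E n (F : 'I_n -> copower E) :
  exists s : seq K, forall i j, j \notin s -> component E (F i) j = 0.
Proof.
have /boolp.choice[s sP] i := componentP (F i).
exists (flatten (codom s)) => i j js; apply: sP; apply: contra js => js.
by apply/flattenP; exists (s i) => //; exact: codom_f.
Qed.

Lemma fin_supp_comp E N (g : E -> N) (f : copower E) :
  g 0 = 0 -> fin_supp (g \o component E f).
Proof.
by move=> g0; have [s fs] := componentP f; exists s => j js; rewrite -[RHS]g0 -(fs j js).
Qed.

Definition copower_fun E N (g : {linear E -> N}) (f : copower E) : copower N :=
  mk_copower (fin_supp_comp f (linear0 g)).

Fact copower_fun_linear E N (g : {linear E -> N}) : linear (copower_fun g).
Proof.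
by move=> a f f'; apply/copowerP => j; rewrite linearP /= !fctE /= linearP.
Qed.

Definition copower_map E N (g : {linear E -> N}) :
  {linear copower E -> copower N} := mk_linear (copower_fun_linear g).

(** Preimages are chosen to vanish outside the support, so that they form
    again a family of finite support. *)
Lemma copower_lift E N (g : {linear E -> N}) (f : copower N) :
  (forall j, exists e, g e = component N f j) ->
  exists f', copower_map g f' = f.
Proof.
move=> im; have [s fs] := componentP f.
have /boolp.choice[e eP] j : exists e, (j \notin s -> e = 0) /\ g e = component N f j.
  have [e ge] := im j; have [js|js] := boolP (j \in s); first by exists e.
  by exists 0; rewrite fs// linear0.
have es : fin_supp e by exists s => j js; have [->] := eP j.
by exists (mk_copower es); apply/copowerP => j; have [_] := eP j.
Qed.

Lemma copower_short_exact (L M N : lmodType R)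
    (f : {linear L -> M}) (g : {linear M -> N}) :
  short_exact f g -> short_exact (copower_map f) (copower_map g).
Proof.
move=> [f_inj fg g_surj]; split=> [x y /copowerP xy|y|z].
- by apply/copowerP => j; apply: f_inj; exact: xy.
- split=> [/copowerP gy|[x <-]].
    by apply: copower_lift => j; apply/(fg _).1/gy.
  by apply/copowerP => j; apply/fg; exists (component L x j).
- by apply: copower_lift => j; exact: g_surj.
Qed.

(** Let phi be a linear map from a left ideal J to the sum.  As J has finitely
    many generators, the values of phi vanish outside a finite set s of
    components.  Each component of phi extends to R, hence is multiplication by
    some e_j, and taking e_j = 0 outside s gives an element of the sum. *)
Lemma copower_injective E :
  left_noetherian R -> injective_module E -> injective_module (copower E).
Proof.
move=> noeth injE; apply: baer_injective => J phi JI phiD phiM.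
have [n [a JE]] := noeth J JI.
have [J0 JD JM] := JI.
have Ja i : J (a i).
  rewrite JE; exists (fun j => (j == i)%:R).
  by rewrite (bigD1 i)//= big1 ?addr0 ?eqxx ?mul1r// => j /negPf->; rewrite mul0r.
have phi0 : phi 0 = 0 by have := phiM 0 0 J0; rewrite mul0r scale0r.
have phiS (c : 'I_n -> R) : phi (\sum_i c i * a i) = \sum_i c i *: phi (a i).
  have : J (\sum_i c i * a i) /\ phi (\sum_i c i * a i) = \sum_i c i *: phi (a i).
    apply: (big_rec2 (fun x y => J x /\ phi x = y)) => // i x y _ [Jx <-].
    have Jc : J (c i * a i) by exact: JM.
    by split; [exact: JD|rewrite phiD// phiM].
  by case.
have [s sP] := copower_common_supp (fun i => phi (a i)).
have dL : linear (fun c : 'I_n -> R^o => \sum_i c i * a i : R^o).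
  move=> r x y; rewrite scaler_sumr -big_split; apply: eq_bigr => i _ /=.
  change ((r * x i + y i) * a i = r * (x i * a i) + y i * a i).
  by rewrite mulrDl mulrA.
have psiL j : linear (fun c : 'I_n -> R^o => \sum_i (c i : R) *: component E (phi (a i)) j).
  move=> r x y; rewrite scaler_sumr -big_split; apply: eq_bigr => i _ /=.
  change ((r * x i + y i : R) *: component E (phi (a i)) j =
    r *: ((x i : R) *: component E (phi (a i)) j) + (y i : R) *: component E (phi (a i)) j).
  by rewrite scalerDl -scalerA.
(* J is the image of R^n -> R, c |-> sum c_i a_i, so a map on J is a map on R^n
   vanishing on the kernel. *)
have ext j : exists e : E, forall c : 'I_n -> R,
    \sum_i c i *: component E (phi (a i)) j = (\sum_i c i * a i) *: e.
  have [c /= dc|g gP] := @injective_extend _ _ _ (mk_linear dL) E (mk_linear (psiL j)) injE.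
    have : component E (phi (\sum_i c i * a i)) j = 0.
      by have -> : \sum_i c i * a i = 0; [exact: dc|rewrite phi0 linear0].
    by rewrite phiS linear_sum fct_sumE.
  exists (g (1 : R^o)) => c; rewrite -linearZ; have /= <- := gP c.
  by congr (g _); exact/esym/(mulr1 _).
have /boolp.choice[e eP] j : exists e : E, (j \notin s -> e = 0) /\
    forall c : 'I_n -> R,
    \sum_i c i *: component E (phi (a i)) j = (\sum_i c i * a i) *: e.
  have [e eP] := ext j; have [js|js] := boolP (j \in s); first by exists e.
  exists 0; split=> // c; rewrite scaler0 big1// => i _.
  by rewrite sP// scaler0.
have es : fin_supp e by exists s => j js; have [->] := eP j.
exists (mk_copower es) => x; rewrite JE => -[c ->].
rewrite phiS; apply/copowerP => j; have [_ /(_ c)] := eP j.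
by rewrite linear_sum fct_sumE linearZ /= !fctE => <-.
Qed.

Lemma copower_injdim n E :
  left_noetherian R -> injdim_le n E -> injdim_le n (copower E).
Proof.
move=> noeth; elim: n E => [|n IH] E; first exact: copower_injective.
move=> [E0 [N [i [q [injE0 iq dimN]]]]].
exists (copower E0), (copower N), (copower_map i), (copower_map q).
split; [exact: copower_injective|exact: copower_short_exact|exact: IH].
Qed.

End Copower.
Arguments component {R K E}.

(** * Hom-exactness of acyclic complexes of projectives *)

Section HomExactness.
Context (R : pzRingType).
Implicit Types (X : complex (Mod R)) (M N E P : lmodType R).

Definition cdiff_lin X (n : int) :
  {linear (X n : lmodType R) -> (X (n - 1) : lmodType R)} := cdiff X n.

Lemma cdiff_linK X n x : cdiff_lin X (n - 1) (cdiff_lin X n x) = 0.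
Proof. exact: (congr1 (fun h : {linear _ -> _} => h x) (cdiffK X n)). Qed.

Definition hom_exact_elt X M : Prop :=
  forall (n : int) (f : {linear (X (n - 1) : lmodType R) -> M}),
    (forall x, f (cdiff_lin X n x) = 0) ->
    exists g : {linear (X (n - 1 - 1) : lmodType R) -> M},
      forall x, g (cdiff_lin X (n - 1) x) = f x.

Lemma hom_exactP X M : hom_exact X M <-> hom_exact_elt X M.
Proof.
split=> XM n f.
  move=> f0; have [|g gf] := (XM n f).1; first by apply: linear_eq => x; exact: f0.
  by exists g => x; exact: (congr1 (fun h : {linear _ -> _} => h x) gf).
split=> [f0|[g <-]].
  have [|g gf] := XM n f.
    by move=> x; exact: (congr1 (fun h : {linear _ -> _} => h x) f0).
  by exists g; apply: linear_eq => x; exact: gf.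
apply: linear_eq => x /=; rewrite -[RHS](linear0 g); congr (g _); exact: cdiff_linK.
Qed.

(** Projectivity, applied to the corestriction of q to its image. *)
Lemma projective_lift P M N (q : {linear M -> N}) (f : {linear P -> N}) :
  projective_module P -> (forall x, exists m, q m = f x) ->
  exists g : {linear P -> M}, forall x, q (g x) = f x.
Proof.
move=> projP im.
have [x|x b b' bx b'x|c x x' b b' bx b'x|f' f'P] :=
  @linear_choice R P (image_mod q) (fun x b => image_val b = f x).
- by have [m <-] := im x; exists (image_in q m).
- by apply: image_val_inj; rewrite bx b'x.
- by rewrite !linearP bx b'x.
have qL : linear (image_in q).
  by move=> a x y; apply: image_val_inj; rewrite linearP; exact: (linearP q).
have [b|g gP] := projP _ _ (mk_linear qL) f'.
  by have [m mb] := image_valP b; exists m; apply: image_val_inj; exact: mb.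
exists g => x; rewrite -f'P; exact/esym/(congr1 image_val (gP x)).
Qed.

(** Dimension shifting along 0 -> M -> E -> N -> 0.  If f : X_(i-1) -> M kills
    boundaries, then j f = g d in E.  The map q g kills boundaries in N, so
    q g = h d, and h lifts to some h' in E since the term is projective.
    Correcting g by h' d makes it land in M. *)
Lemma injdim_hom_exact X M n : acyclic X ->
  (forall i, projective_module (X i)) -> injdim_le n M -> hom_exact X M.
Proof.
move=> acX projX dimM; apply/hom_exactP.
elim: n M dimM => [|n IH] M.
  move=> injM i f f0; apply: injective_extend => // x dx.
  by have [y <-] := (acX i x).1 dx; exact: f0.
move=> [E [N [j [q [injE [j_inj jq q_surj] dimN]]]]] i f f0.
have XE : hom_exact_elt X E.
  by move=> l h h0; apply: injective_extend => // x dx; have [y <-] := (acX l x).1 dx.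
have [x|g gP] := XE i (lin_comp j f); first by rewrite /= f0 linear0.
have [x|h hP] := IH N dimN (i - 1) (lin_comp q g).
  by rewrite /= gP; apply/jq; exists (f x).
have [h' h'P] := projX _ _ _ q h q_surj.
pose g' : {linear _ -> E} := g \- lin_comp h' (cdiff_lin X (i - 1 - 1)).
have [x|g'' g''P] := @projective_lift _ _ _ j g' (projX _).
  apply/jq; rewrite /= linearB /=.
  by have /= <- := h'P (cdiff_lin X (i - 1 - 1) x); have /= -> := hP x; rewrite subrr.
exists g'' => x; apply: j_inj; rewrite g''P /= cdiff_linK linear0 subr0; exact: gP.
Qed.

Lemma hom_exact_retract X M N (i : {linear M -> N}) (r : {linear N -> M}) :
  cancel i r -> hom_exact X N -> hom_exact X M.
Proof.
move=> ri /hom_exactP XN; apply/hom_exactP => n f f0.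
have [x|g gP] := XN n (lin_comp i f); first by rewrite /= f0 linear0.
by exists (lin_comp r g) => x /=; rewrite gP /= ri.
Qed.

End HomExactness.

Section DualBasis.
Context (R : pzRingType) (P : lmodType R).
Local Notation free := (@copower R P R^o).

Definition combination (f : free) : P :=
  \sum_(x \in [set: P]) (component f x : R) *: x.

Lemma combinationE (f : free) (s : seq P) : uniq s ->
  (forall x, x \notin s -> component f x = 0) ->
  combination f = \sum_(x <- s) (component f x : R) *: x.
Proof.
move=> us fs; rewrite /combination (fsbigE s) //.
  by apply: eq_bigl => x; rewrite in_setT.
by move=> x _ xs; rewrite fs// scale0r.
Qed.

Lemma combination_linear : linear combination.
Proof.
move=> a f g; have [s fs] := componentP f; have [t gt] := componentP g.
have supp (h : free) : (forall x, x \notin s ++ t -> component h x = 0) ->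
    combination h = \sum_(x <- undup (s ++ t)) (component h x : R) *: x.
  move=> h0; apply: combinationE; first exact: undup_uniq.
  by move=> x; rewrite mem_undup; exact: h0.
have fst x : x \notin s ++ t -> component f x = 0 /\ component g x = 0.
  by rewrite mem_cat negb_or => /andP[/fs + /gt].
rewrite !supp => [|x /fst[]//|x /fst[]//|x /fst[f0 g0]].
  rewrite scaler_sumr -big_split; apply: eq_bigr => x _ /=.
  change ((a * component f x + component g x : R) *: x =
    a *: ((component f x : R) *: x) + (component g x : R) *: x).
  by rewrite scalerDl -scalerA.
by rewrite linearP !fctE f0 g0 scaler0 addr0.
Qed.

(** The family of all elements of P generates P, so P is a retract of the free
    module on the underlying set of P. *)
Lemma free_cover :
  projective_module P ->
  exists s : {linear P -> free}, forall x, combination (s x) = x.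
Proof.
move=> projP.
have [x|g gP] := projP _ _ (mk_linear combination_linear) idfun.
  have xs : fin_supp (fun y => (y == x)%:R : R^o).
    by exists [:: x] => y; rewrite inE => /negPf ->.
  exists (mk_copower xs); rewrite /= (@combinationE _ [:: x])//.
    by rewrite big_seq1 /= eqxx scale1r.
  by move=> y; rewrite inE => /negPf yx; rewrite component_mk yx.
by exists g => x; have /= := gP x.
Qed.

(** The dual basis property.  One finite set s of indices serves for a whole list
    of elements, so that an element of X \otimes P can be expanded at once. *)
Lemma dual_basis : projective_module P ->
  exists f : P -> {linear P -> R^o}, forall l : seq P,
    exists s : seq P, {in l, forall m, m = \sum_(x <- s) (f x m : R) *: x}.
Proof.
move=> /free_cover[g gP].
have fL x : linear (fun m => component (g m) x : R^o).
  by move=> a y z; rewrite !linearP.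
exists (fun x => mk_linear (fL x)) => l.
have [s sP] := copower_common_supp (fun i : 'I_(size l) => g l`_i).
exists (undup s) => m ml; rewrite -{1}[m]gP; apply: combinationE.
  exact: undup_uniq.
move=> x; rewrite mem_undup; rewrite -index_mem in ml.
by have := sP (Ordinal ml) x; rewrite /= nth_index// -index_mem.
Qed.

Lemma projective_hom_exact (X : complex (Mod R)) :
  left_noetherian R -> finite_injdim (R^o : lmodType R) ->
  acyclic X -> (forall i, projective_module (X i)) ->
  projective_module P -> hom_exact X P.
Proof.
move=> noeth [n dimR] acX projX /free_cover[g gP].
apply: (@hom_exact_retract _ _ _ _ g (mk_linear combination_linear) gP).
exact: injdim_hom_exact acX projX (copower_injdim P noeth dimR).
Qed.

End DualBasis.

(** * Unit and counit of the adjunction *)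

Section Adjunction.
Context (k : fieldType) (p : nat) (G : topologicalGroupType).
Context (I : open_pro_p p G).
Implicit Types (M N P : lmodType (hecke k I)) (V W : smooth_rep k G).
Local Notation X := (ind_rep k I).
Local Notation U := (inv_mod I).
Local Notation Umap := (@inv_map k p G I _ _).
Local Notation F := ind_tensor.
Local Notation Fmap := ind_tensor_map.
Local Notation ival := (inv_val I _).
Local Notation one := (ind_one k I).

Lemma tensor_gen M (a : tensor M) :
  exists s : formal M, a = \sum_(z <- s) pure_tensor z.1 z.2.
Proof.
elim/tensorW: a => s; exists s; elim: s => [|[x m] s IH]; first by rewrite big_nil.
by rewrite big_cons -IH -cat1s ten_sum_cat.
Qed.

Lemma tensor_ext M (A : zmodType) (f g : {additive tensor M -> A}) :
  (forall x m, f (pure_tensor x m) = g (pure_tensor x m)) -> f =1 g.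
Proof.
move=> fg a; have [s ->] := tensor_gen a.
by rewrite !raddf_sum; apply: eq_bigr => z _; exact: fg.
Qed.

Lemma pure_tensorDr M x (m n : M) :
  pure_tensor x (m + n) = pure_tensor x m + pure_tensor x n.
Proof. by rewrite -ten_sum_cat; apply/ten_sumP; exact: TenAddr. Qed.

Lemma pure_tensorDl M x y (m : M) :
  pure_tensor (x + y) m = pure_tensor x m + pure_tensor y m.
Proof. by rewrite -ten_sum_cat; apply/ten_sumP; exact: TenAddl. Qed.

Lemma pure_tensor_balanced M x (h : hecke k I) (m : M) :
  pure_tensor ((h : rep_hom X X) x) m = pure_tensor x (h *: m).
Proof. by apply/ten_sumP; exact: TenBalanced. Qed.

Lemma pure_tensorZl M a x (m : M) : pure_tensor (a *: x) m = a *: pure_tensor x m.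
Proof. exact/esym/ten_maplE/balanced_scale. Qed.

Lemma pure_tensor_act M g x (m : M) :
  pure_tensor (act g x) m = @act _ _ (F M) g (pure_tensor x m).
Proof. exact/esym/ten_maplE/balanced_act. Qed.

Lemma Fmap_pure M N (f : {linear M -> N}) x m :
  Fmap f (pure_tensor x m) = pure_tensor x (f m).
Proof. exact: ten_maprE. Qed.

Lemma pure_tensor_sumr M x (s : seq M) (c : M -> M) :
  pure_tensor x (\sum_(m <- s) c m) = \sum_(m <- s) pure_tensor x (c m).
Proof.
elim: s => [|m s IH]; last by rewrite !big_cons pure_tensorDr IH.
rewrite !big_nil; apply: (addrI (pure_tensor x (0 : M))).
by rewrite -pure_tensorDr !addr0.
Qed.

Section Counit.
Context (V : smooth_rep k G).

(** On pure tensors the counit is x \otimes v |-> phi(x), where phi : X -> V is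
    the G-map sending 1_I to v. *)
Definition counit_formal (s : formal (U V)) : V :=
  \sum_(z <- s) frob_fun (ival z.2) z.1.

Lemma counit_formal_eq s t : ten_eq s t -> counit_formal s = counit_formal t.
Proof.
rewrite /counit_formal.
elim=> {s t} [s|s t _|s t u _ h1 _|s s' t t' _ h1 _ h2|s t|m|x y m|x m n|x h m].
- by [].
- by move=> ->.
- by rewrite h1.
- by rewrite !big_cat /= h1 h2.
- by rewrite !big_cat /= addrC.
- by rewrite big_seq1 big_nil linear0.
- by rewrite !big_cons !big_nil !addr0 linearD.
- by rewrite !big_cons !big_nil !addr0 /= frob_funD.
- by rewrite !big_seq1 /=; exact/esym/frob_hecke_act.
Qed.

Definition counit_fun (a : tensor (U V)) : V := counit_formal (repr a).

Lemma counit_sum s : counit_fun (ten_sum s) = counit_formal s.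
Proof. exact/counit_formal_eq/repr_ten. Qed.

Fact counit_additive a b : counit_fun (a + b) = counit_fun a + counit_fun b.
Proof.
elim/tensorW: a => s; elim/tensorW: b => t.
by rewrite -ten_sum_cat !counit_sum /counit_formal big_cat.
Qed.

Lemma counit_fun_pure x v : counit_fun (pure_tensor x v) = frob_fun (ival v) x.
Proof. by rewrite counit_sum /counit_formal big_seq1. Qed.

Lemma counit_fun0 : counit_fun 0 = 0.
Proof. by apply: (addrI (counit_fun 0)); rewrite -counit_additive !addr0. Qed.

Fact counit_linear : linear counit_fun.
Proof.
move=> c a b; rewrite counit_additive; congr (_ + _).
have [s ->] := tensor_gen a; rewrite scaler_sumr.
elim: s => [|[x m] s IH]; first by rewrite !big_nil counit_fun0 scaler0.
rewrite !big_cons !counit_additive IH scalerDr; congr (_ + _).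
by rewrite -pure_tensorZl !counit_fun_pure linearZ.
Qed.

Fact counit_act g a : counit_fun (@act _ _ (F (U V)) g a) = act g (counit_fun a).
Proof.
have [s ->] := tensor_gen a; rewrite linear_sum /=.
elim: s => [|[x m] s IH]; first by rewrite !big_nil counit_fun0 linear0.
rewrite !big_cons !counit_additive IH linearD; congr (_ + _).
apply: etrans (congr1 counit_fun (esym (pure_tensor_act g x m))) _.
by rewrite !counit_fun_pure frob_act//; exact: inv_valP.
Qed.

Definition counit : rep_hom (F (U V)) V :=
  @RepHom _ _ (F (U V)) V (mk_linear counit_linear) counit_act.

Lemma counit_pure x v : counit (pure_tensor x v) = frob_fun (ival v) x.
Proof. exact: counit_fun_pure. Qed.

End Counit.

(** Both sides send x \otimes v to the value at x of the G-map X -> W sending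
    1_I to f(v). *)
Lemma counit_nat V W (f : rep_hom V W) a :
  counit W (Fmap (Umap f) a) = f (counit V a).
Proof.
apply: (@tensor_ext _ _ (rhom_comp (counit W) (Fmap (Umap f))) (rhom_comp f (counit V))).
move=> x v; change (counit W (Fmap (Umap f) (pure_tensor x v)) =
  f (counit V (pure_tensor x v))).
rewrite Fmap_pure !counit_pure.
have /= -> := frob_uniq (rhom_comp f (frob (inv_valP v))) x.
by rewrite frob_one //; exact: inv_valP.
Qed.

Section Unit.
Context (M : lmodType (hecke k I)).

Lemma pure_tensor_linear (m : M) : linear (pure_tensor ^~ m : X -> F M).
Proof. by move=> a x y; rewrite pure_tensorDl pure_tensorZl. Qed.

Definition tensor_with (m : M) : rep_hom X (F M) :=
  @RepHom _ _ X (F M) (mk_linear (pure_tensor_linear m))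
    (fun g x => pure_tensor_act g x m).

Lemma one_tensor_fixed (m : M) : I_fixed I (pure_tensor one m : F M).
Proof. exact: hom_fixed (tensor_with m) _ (@ind_one_fixed k p G I). Qed.

Lemma frob_one_tensor (m : M) x :
  frob_fun (pure_tensor one m : F M) x = pure_tensor x m.
Proof. by have /esym := frob_uniq (tensor_with m) x. Qed.

(** The unit m |-> 1_I \otimes m.  Its H-linearity expresses that the G-map
    X -> X \otimes_H M sending 1_I to 1_I \otimes m is x |-> x \otimes m. *)
Definition unit_fun (m : M) : U (F M) := inv_in (one_tensor_fixed m).

Fact unit_linear : linear unit_fun.
Proof.
move=> h m n; apply: inv_val_inj; rewrite raddfD.
rewrite [LHS]pure_tensorDr; congr (_ + _).
by rewrite -pure_tensor_balanced; exact/esym/frob_one_tensor.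
Qed.

Definition unit_map : {linear M -> U (F M)} := mk_linear unit_linear.

(** One of the triangle identities. *)
Lemma counit_unit a : counit (F M) (Fmap unit_map a) = a.
Proof.
apply: (@tensor_ext _ _ (rhom_comp (counit (F M)) (Fmap unit_map)) idfun).
move=> x m; change (counit (F M) (Fmap unit_map (pure_tensor x m)) = pure_tensor x m).
by rewrite Fmap_pure counit_pure frob_one_tensor.
Qed.

End Unit.

Lemma unit_nat M N (f : {linear M -> N}) m :
  Umap (Fmap f) (unit_map M m) = unit_map N (f m).
Proof. by apply: inv_val_inj; exact: Fmap_pure. Qed.

(** The map h |-> 1_I h from H to X^I, which is the unit of the module H followed
    by the isomorphism of X \otimes_H H with X. *)
Definition orbit_fun (h : (hecke k I)^o) : U X :=
  (h : hecke k I) *: (inv_in (@ind_one_fixed k p G I) : U X).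
Fact orbit_linear : linear orbit_fun.
Proof. by move=> a x y; rewrite /orbit_fun scalerDl -scalerA. Qed.

Section DualCoordinates.
Context (P : lmodType (hecke k I)) (f : {linear P -> (hecke k I)^o}).

(** The map X \otimes_H P -> X \otimes_H H = X induced by a linear form f on
    P. *)
Definition dual_map : rep_hom (F P) X :=
  rhom_comp (counit X) (Fmap (lin_comp (mk_linear orbit_linear) f)).

Lemma dual_map_pure x m : dual_map (pure_tensor x m) = (f m : rep_hom X X) x.
Proof.
change (counit X (Fmap (lin_comp (mk_linear orbit_linear) f)
  (pure_tensor x m)) = (f m : rep_hom X X) x).
rewrite Fmap_pure counit_pure.
apply: (etrans (frob_hecke_act _ _ _)).
by have /esym := frob_uniq (rhom_id X) ((f m : rep_hom X X) x).
Qed.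
End DualCoordinates.

(** If 1_I \otimes m = 0, every linear form f of a dual basis satisfies
    1_I f(m) = 0 in X.  Since X is generated by 1_I, the endomorphism f(m) is
    zero, hence so is m. *)
Lemma unit_injective P : projective_module P -> injective (unit_map P).
Proof.
move=> /dual_basis[f fP]; suff inj0 m : unit_map P m = 0 -> m = 0.
  move=> m n E; apply/subr0_eq/inj0; by rewrite linearB E subrr.
move=> m0; have [s sP] := fP [:: m].
rewrite (sP m) ?inE// big1// => x _.
suff -> : f x m = 0 by rewrite scale0r.
have one0 : (f x m : rep_hom X X) one = 0.
  rewrite -dual_map_pure -[RHS](linear0 (dual_map (f x))); congr (dual_map _ _).
  exact: (congr1 ival m0).
apply: rep_hom_eq => y; rewrite (frob_uniq (f x m : rep_hom X X)) one0.
have /= <- := frob_uniq (rhom_zero X X) y.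
by [].
Qed.

(** With a dual basis (x, f_x), any w in X \otimes_H P is the sum of the
    F(f_x)(w) \otimes x.  If w is fixed by I, so is F(f_x)(w), which is then
    1_I h_x for some h_x in H; therefore w = 1_I \otimes sum h_x x. *)
Lemma unit_surjective P : projective_module P ->
  forall v, exists m, unit_map P m = v.
Proof.
move=> /dual_basis[f fP] v; pose w : F P := ival v.
have [s ws] := tensor_gen w.
have [t tP] := fP [seq z.2 | z <- s].
have wE : w = \sum_(x <- t) pure_tensor (dual_map (f x) w) x.
  under eq_bigr => x _ do rewrite ws.
  rewrite {1}ws.
  transitivity (\sum_(z <- s) \sum_(x <- t)
    pure_tensor (dual_map (f x) (pure_tensor z.1 z.2)) x).
    apply: eq_big_seq => z zs; rewrite [in LHS](tP z.2); last exact: map_f.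
    rewrite pure_tensor_sumr; apply: eq_bigr => x _.
    by rewrite dual_map_pure pure_tensor_balanced.
  rewrite exchange_big; apply: eq_bigr => x _.
  move: (dual_map (f x)) => D; elim: (s) => [|z s' IH].
    have := pure_tensorZl 0 0 x.
    rewrite !big_nil !scale0r => E; apply: etrans (esym E) _.
    by congr (pure_tensor _ x); exact/esym/(linear0 D).
  rewrite !big_cons IH; apply: etrans (esym (pure_tensorDl _ _ _)) _; congr (pure_tensor _ x).
  exact/esym/(linearD D).
have /boolp.choice[h hP] x : exists h : hecke k I,
    (h : rep_hom X X) one = dual_map (f x) w.
  have fixw : I_fixed I (dual_map (f x) w) by exact: hom_fixed (inv_valP v).
  by exists (frob fixw); exact: frob_one.
exists (\sum_(x <- t) h x *: x); apply: inv_val_inj; apply: etrans (esym wE).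
rewrite linear_sum raddf_sum; apply: eq_bigr => x _.
by rewrite -hP; exact/esym/pure_tensor_balanced.
Qed.

End Adjunction.

(** * I-projective representations *)

Lemma linear_inverse (R : pzRingType) (M N : lmodType R) (f : {linear M -> N}) :
  injective f -> (forall n, exists m, f m = n) ->
  exists g : {linear N -> M}, cancel f g /\ cancel g f.
Proof.
move=> f_inj f_surj.
have [//|n m m' <- /f_inj//|a n n' m m' <- <-|g gP] :=
    @linear_choice R N M (fun n m => f m = n).
  by rewrite linearP.
by exists g; split=> // m; apply: f_inj; rewrite gP.
Qed.

Lemma linear_iso (R : pzRingType) (M N : lmodType R) (f : {linear M -> N}) :
  injective f -> (forall n, exists m, f m = n) -> @is_iso (Mod R) M N f.
Proof.
move=> f_inj f_surj; have [g [fK gK]] := linear_inverse f_inj f_surj.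
by exists g; split; apply: linear_eq => x; [exact: fK|exact: gK].
Qed.

Section Reps.
Context (k : fieldType) (G : topologicalGroupType).
Implicit Types V W : smooth_rep k G.

Lemma rep_iso V W (f : rep_hom V W) :
  injective f -> (forall w, exists v, f v = w) -> @is_iso (Rep k G) V W f.
Proof.
move=> f_inj f_surj; have [g [fK gK]] := linear_inverse f_inj f_surj.
have g_act x w : g (act x w) = act x (g w).
  by apply: f_inj; rewrite rhom_act !gK.
by exists (RepHom g_act); split; apply: rep_hom_eq => x; [exact: fK|exact: gK].
Qed.

Lemma rep_iso_bij V W : iso (V : Rep k G) W -> exists f : rep_hom V W,
  injective f /\ (forall w, exists v, f v = w).
Proof.
move=> [f [g [gf fg]]]; exists f; split=> [|w].
  by apply: can_inj (g : rep_hom _ _) _ => v;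
    exact: (congr1 (fun h : rep_hom _ _ => h v) gf).
exists ((g : rep_hom _ _) w); exact: (congr1 (fun h : rep_hom _ _ => h w) fg).
Qed.

(** The retraction is the first component of the inverse of V + V' -> W. *)
Lemma summand_retract V W : direct_summand V W ->
  exists (i : rep_hom V W) (r : rep_hom W V), cancel i r.
Proof.
move=> [V' [i [j [g fK gK]]]]; exists i.
have rL : linear (fun w => (g w).1).
  move=> a w w'.
  suff -> : g (a *: w + w') = a *: g w + g w' by [].
  apply: (can_inj fK); rewrite gK /= !linearP addrACA -scalerDr !gK.
  by [].
have r_act x w : (mk_linear rL) (act x w) = act x (mk_linear rL w).
  suff /= -> : g (act x w) = (act x (g w).1, act x (g w).2) by [].
  by apply: (can_inj fK); rewrite gK /= !rhom_act -linearD gK.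
exists (RepHom r_act) => v /=.
by rewrite -[i v]addr0 -(linear0 j) (fK (v, 0)).
Qed.

Lemma summand_refl V : direct_summand V V.
Proof.
exists (im_rep (rhom_zero V V)), (rhom_id V), (rhom_zero _ _).
have z (w : im_rep (rhom_zero V V)) : w = 0.
  by apply: im_lval_inj; have [v /= <-] := im_valP w.
exists (fun v => (v, 0)) => [[v w]|v] /=; last by rewrite addr0.
by rewrite addr0 -(z w).
Qed.
Definition im_incl V W (f : rep_hom V W) : rep_hom (im_rep f) W :=
  @RepHom _ _ (im_rep f) W im_lval (fun _ _ => erefl).
End Reps.

Section IProjective.
Context (k : fieldType) (p : nat) (G : topologicalGroupType).
Context (I : open_pro_p p G).
Implicit Types (L M N P : lmodType (hecke k I)) (V W : smooth_rep k G).
Local Notation U := (inv_mod I).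
Local Notation Umap := (inv_map I).
Local Notation F := ind_tensor.
Local Notation Fmap := ind_tensor_map.

Lemma Fmap_id M a : Fmap (lin_id M) a = a.
Proof. exact: (congr1 (fun h : rep_hom _ _ => h a) (fmor1 (functorF k I) M)). Qed.

Lemma Fmap_comp L M N (g : {linear M -> N}) (f : {linear L -> M}) a :
  Fmap (lin_comp g f) a = Fmap g (Fmap f a).
Proof. exact: (congr1 (fun h : rep_hom _ _ => h a) (fmorM (functorF k I) g f)). Qed.

Lemma Fmap_eq M N (f g : {linear M -> N}) a : f =1 g -> Fmap f a = Fmap g a.
Proof. by move=> /linear_eq ->. Qed.

Lemma projective_retract M P (i : M -> P) (u : {linear P -> M}) :
  linear i -> cancel i u -> projective_module P -> projective_module M.
Proof.
move=> iL iK projP A B q f q_surj.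
have [g gP] := projP _ _ q (lin_comp f u) q_surj.
by exists (lin_comp g (mk_linear iL)) => m; apply: etrans (gP (i m)); rewrite /= iK.
Qed.

Lemma unit_inverse P : projective_module P ->
  exists u : {linear U (F P) -> P}, cancel (unit_map P) u /\ cancel u (unit_map P).
Proof.
by move=> projP; apply: linear_inverse; [exact: unit_injective|exact: unit_surjective].
Qed.

Lemma I_projective_free P : projective_module P -> I_projective I (F P).
Proof. by move=> projP; exists P; split=> //; exact: summand_refl. Qed.

(** UV is a retract of U F P, which is isomorphic to P by the unit. *)
Lemma I_projective_projective V : I_projective I V -> projective_module (U V).
Proof.
move=> [P [projP /summand_retract[i [r iK]]]].
have [u [uK uK']] := unit_inverse projP.
apply: (@projective_retract _ P (lin_comp u (Umap i)) (lin_comp (Umap r) (unit_map P))) => //.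
  exact: linearP.
move=> v; change (Umap r (unit_map P (u (Umap i v))) = v).
by rewrite uK'; apply: inv_val_inj; exact: iK.
Qed.

(** The triangle identity makes the counit at F P a left inverse of F applied to
    the unit, which is invertible. *)
Lemma counit_F_injective P : projective_module P -> injective (counit I (F P)).
Proof.
move=> projP; have [u [uK uK']] := unit_inverse projP.
have uF a : Fmap (unit_map P) (Fmap u a) = a.
  by rewrite -Fmap_comp -[RHS]Fmap_id; apply: Fmap_eq => v; exact: uK'.
by move=> a b; rewrite -(uF a) -(uF b) !counit_unit => ->.
Qed.

(** By naturality the counit at V is a retract of the counit at F P. *)
Lemma counit_injective V : I_projective I V -> injective (counit I V).
Proof.
move=> [P [projP /summand_retract[i [r iK]]]].
have iF a : Fmap (Umap r) (Fmap (Umap i) a) = a.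
  rewrite -Fmap_comp -[RHS]Fmap_id; apply: Fmap_eq => v; apply: inv_val_inj.
  exact: iK.
move=> a b E; rewrite -(iF a) -(iF b); congr (Fmap _ _).
by apply: (counit_F_injective projP); rewrite !counit_nat E.
Qed.

Lemma counit_surjective V : I_projective I V ->
  forall v, exists a, counit I V a = v.
Proof.
move=> [P [projP /summand_retract[i [r iK]]]] v.
exists (Fmap (Umap r) (Fmap (unit_map P) (i v))).
by rewrite counit_nat counit_unit iK.
Qed.

End IProjective.

(** * The module complex of invariants *)

Section DegreeZero.
Context (R : pzRingType) (X : complex (Mod R)).

(** The index 1 - 1 computes to 0, so that the first differential can be given
    the target X_0. *)
Definition d1 : {linear (X 1 : lmodType R) -> (X 0 : lmodType R)} := cdiff_lin X 1.

Lemma d1K y : cdiff_lin X 0 (d1 y) = 0.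
Proof. exact: (@cdiff_linK R X 1). Qed.

Definition to_cycles_fun (y : (X 1 : lmodType R)) : cycles0 X := ker_in (d1K y).

Fact to_cycles_linear : linear to_cycles_fun.
Proof. by move=> a y z; apply: ker_val_inj; rewrite /= linearP. Qed.

Definition to_cycles : {linear (X 1 : lmodType R) -> cycles0 X} :=
  mk_linear to_cycles_linear.

Hypothesis acX : acyclic X.

Lemma cycle_boundary (z : (X 0 : lmodType R)) :
  cdiff_lin X 0 z = 0 -> exists y, d1 y = z.
Proof. exact: (@acX 1 z).1. Qed.

Lemma to_cycles_surjective z : exists y, to_cycles y = z.
Proof.
by have [y yz] := cycle_boundary (ker_valK z); exists y; apply: ker_val_inj.
Qed.

(** When X is acyclic, f factors through Z_0 X; hom-exactness extends it from
    Z_0 X to X_0. *)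
Lemma extend_d1 (M : lmodType R) (f : {linear (X 1 : lmodType R) -> M}) :
  hom_exact X M -> (forall y, d1 y = 0 -> f y = 0) ->
  exists g : {linear (X 0 : lmodType R) -> M}, forall y, g (d1 y) = f y.
Proof.
move=> /hom_exactP XM f0; apply: (XM 2 f) => x; apply: f0.
exact: (@cdiff_linK R X 2).
Qed.
End DegreeZero.

Section UComplex.
Context (k : fieldType) (p : nat) (G : topologicalGroupType).
Context (I : open_pro_p p G).
Local Notation U := (inv_mod I).
Local Notation Umap := (inv_map I).
Local Notation F := ind_tensor.
Local Notation Fmap := ind_tensor_map.

Lemma functorU0 (V W : Rep k G) :
  fmor (functorU k I) (zerom V W) = zerom (functorU k I V) (functorU k I W).
Proof. by apply: linear_eq => v; apply: inv_val_inj. Qed.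

Definition U_complex (X : complex (Rep k G)) : complex (Mod (hecke k I)) :=
  termwise_obj functorU0 X.

Lemma U_complex_acyclic X : I_exact_complex I X -> acyclic (U_complex X).
Proof. by move=> exX n; have [] := exX n. Qed.

(** If V is the image of d_1 : X_1 -> X_0, embedded by a, then the invariants of
    V are the 0-cycles of UX.  An invariant vector of V is a boundary, hence a
    cycle.  Conversely a cycle of UX is, by I-exactness, the boundary of an
    I-invariant vector, hence lies in V. *)
Section Presentation.
Context (X : complex (Rep k G)) (V : smooth_rep k G).
Context (a : rep_hom V (X 0 : smooth_rep k G)).
Hypotheses (a_inj : injective a)
  (a_im : forall w, (exists v, a v = w) <-> (exists x, diff1 X x = w)).
Hypothesis exX : I_exact_complex I X.

Lemma diff1K x : (cdiff X 0 : rep_hom _ _) (diff1 X x) = 0.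
Proof. exact: (congr1 (fun h : rep_hom _ _ => h x) (cdiffK X 1)). Qed.

Lemma presentation_cycle (v : U V) : cdiff_lin (U_complex X) 0 (Umap a v) = 0.
Proof.
apply: inv_val_inj.
have [x ax] := (a_im (a (inv_val I V v))).1 (ex_intro _ _ erefl).
change ((cdiff X 0 : rep_hom _ _) (a (inv_val I V v)) = 0).
by rewrite -ax diff1K.
Qed.

Definition presentation_fun (v : U V) : cycles0 (U_complex X) :=
  ker_in (presentation_cycle v).

Fact presentation_linear : linear presentation_fun.
Proof. by move=> c v w; apply: ker_val_inj; exact: (linearP (Umap a)). Qed.

Definition presentation_map : {linear U V -> cycles0 (U_complex X)} :=
  mk_linear presentation_linear.

Lemma presentation_injective : injective presentation_map.
Proof.
move=> v w /(congr1 ker_val)/(congr1 (inv_val I _)) E.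
by apply: inv_val_inj; apply: a_inj.
Qed.

Lemma presentation_surjective z : exists v, presentation_map v = z.
Proof.
have [y yz] := to_cycles_surjective (U_complex_acyclic exX) z.
have [v av] := (a_im (diff1 X (inv_val I _ y))).2 (ex_intro _ _ erefl).
have vI : I_fixed I v.
  move=> i Ii; apply: a_inj; rewrite rhom_act av -rhom_act.
  by rewrite (inv_valP y).
exists (inv_in vI); rewrite -yz; apply: ker_val_inj; apply: inv_val_inj.
exact: av.
Qed.
End Presentation.

Lemma I_gorenstein_presentation V : I_gorenstein_projective I V ->
  exists (X : complex (Rep k G)) (a : rep_hom V (X 0 : smooth_rep k G)),
    [/\ forall n, I_projective I (X n), I_exact_complex I X, injective a &
    forall w, (exists v, a v = w) <-> (exists x, diff1 X x = w)].
Proof.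
move=> [X [projX exX /rep_iso_bij[f [f_inj f_surj]]]].
exists X, (rhom_comp (im_incl (diff1 X)) f).
split=> // [v w /im_lval_inj/f_inj//|w]; split=> [[v <-]|[x <-]].
  exact: im_valP.
have [v fv] := f_surj (im_in (ex_intro _ x erefl)).
by exists v; rewrite /= fv.
Qed.

Hypothesis noeth : left_noetherian (hecke k I).
Hypothesis injdim : finite_injdim ((hecke k I)^o : lmodType (hecke k I)).

Lemma U_complex_hom_exact (X : complex (Rep k G)) (P : lmodType (hecke k I)) :
  (forall n, I_projective I (X n)) ->
  I_exact_complex I X -> projective_module P -> hom_exact (U_complex X) P.
Proof.
move=> projX exX; apply: projective_hom_exact => //.
  exact: U_complex_acyclic.
by move=> n; exact: I_projective_projective.
Qed.

(** UX is an acyclic complex of projectives with Z_0 (UX) = UV. *)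
Lemma U_gorenstein V : I_gorenstein_projective I V ->
  gorenstein_projective (functorU k I V).
Proof.
move=> /I_gorenstein_presentation[X [a [projX exX a_inj a_im]]].
exists (U_complex X); split.
- exact: U_complex_acyclic.
- by move=> n; exact: I_projective_projective.
- by move=> P; exact: U_complex_hom_exact.
- exists (presentation_map a_im); apply: linear_iso.
    exact: presentation_injective.
  exact: presentation_surjective.
Qed.

End UComplex.

(** * Boundaries of induced complexes *)

Section ImageIso.
Context (k : fieldType) (G : topologicalGroupType) (A V W : smooth_rep k G).

Definition im_class (D : rep_hom A W) (a : A) : im_rep D :=
  im_in (ex_intro (fun a' => D a' = D a) a erefl).

Lemma im_classP (D : rep_hom A W) (w : im_rep D) : exists a, im_class D a = w.
Proof. by have [a aw] := im_valP w; exists a; apply: im_lval_inj. Qed.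

(** The image of D and V are both the quotient of A by the common kernel. *)
Lemma image_iso (D : rep_hom A W) (C : rep_hom A V) :
  (forall a, D a = 0 <-> C a = 0) -> (forall v, exists a, C a = v) ->
  exists f : rep_hom (im_rep D) V, @is_iso (Rep k G) (im_rep D) V f /\
    forall a, f (im_class D a) = C a.
Proof.
move=> kerDC C_surj.
have DC a a' : D a = D a' <-> C a = C a'.
  have := kerDC (a - a'); rewrite !linearB => -[h h'].
  by split=> [E|E]; apply/subr0_eq; [apply: h|apply: h']; rewrite E subrr.
have [w|w v v' [a [<- <-]] [a' [aa' <-]]|c w w' v v' [a [<- <-]] [a' [<- <-]]|f fP] :=
  @linear_choice k (im_rep D) V (fun w v => exists a, im_class D a = w /\ C a = v).
- by have [a aw] := im_classP w; exists (C a), a.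
- by apply/DC; have /(congr1 im_lval) := aa'.
- exists (c *: a + a'); split; last by rewrite linearP.
  by apply: im_lval_inj; exact: (linearP D).
have fE a : f (im_class D a) = C a.
  have [a' [aa' <-]] := fP (im_class D a); apply/DC.
  by have /(congr1 im_lval) := aa'.
have f_act g w : f (act g w) = act g (f w).
  have [a <-] := im_classP w; rewrite fE -rhom_act -fE; congr (f _).
  by apply: im_lval_inj; rewrite /= rhom_act.
exists (RepHom f_act); split=> //; apply: rep_iso => [w w'|v].
  have [a <-] := im_classP w; have [a' <-] := im_classP w'.
  by rewrite /= !fE => /DC E; exact: im_lval_inj.
by have [a av] := C_surj v; exists (im_class D a); rewrite /= fE.
Qed.
End ImageIso.

Section FComplex.
Context (k : fieldType) (p : nat) (G : topologicalGroupType).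
Context (I : open_pro_p p G).
Local Notation U := (inv_mod I).
Local Notation Umap := (inv_map I).
Local Notation F := ind_tensor.
Local Notation Fmap := ind_tensor_map.

Definition F_complex (Y : complex (Mod (hecke k I))) : complex (Rep k G) :=
  termwise_obj (@functorF0 k p G I) Y.

Section UnitSide.
Context (Y : complex (Mod (hecke k I))).
Hypotheses (acY : acyclic Y) (projY : forall n, projective_module (Y n)).

(** By the unit, U F Y is termwise isomorphic to the acyclic complex Y. *)
Lemma F_complex_I_exact : I_exact_complex I (F_complex Y).
Proof.
move=> n; split; first exact: (cdiffK (F_complex Y) n).
move=> y; split=> [dy|[x <-]]; last first.
  exact: (congr1 (fun h : {linear _ -> _} => h x) (cdiffK (U_complex I (F_complex Y)) n)).
have [m my] := unit_surjective (@projY _) y.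
have [m' m'm] : exists m', cdiff_lin Y n m' = m.
  apply/(@acY n m)/(unit_injective (@projY _)).
  rewrite linear0 -[RHS]dy -my; exact/esym/unit_nat.
exists (unit_map _ m'); rewrite -my -m'm; exact: unit_nat.
Qed.

Definition boundary_class (b : F (Y 1 : lmodType _)) : boundaries0 (F_complex Y) :=
  im_class (diff1 (F_complex Y)) b.

Lemma unit_boundary (z : cycles0 Y) :
  exists b, diff1 (F_complex Y) b = inv_val I _ (unit_map _ (ker_val z)).
Proof.
have [y <-] := cycle_boundary acY (ker_valK z).
exists (inv_val I _ (unit_map _ y)).
exact: (congr1 (inv_val I _) (unit_nat (d1 Y) y)).
Qed.

Lemma unit_cycle_fixed (z : cycles0 Y) :
  I_fixed I (im_in (unit_boundary z) : boundaries0 (F_complex Y)).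
Proof.
by move=> i Ii; apply: im_lval_inj; exact: (inv_valP (unit_map _ (ker_val z))) Ii.
Qed.

(** The map Z_0 Y -> U(B_0 FY) induced by the unit of Y_0; the tensor
    1_I \otimes z is a boundary since z is one. *)
Definition unit_cycle_fun (z : cycles0 Y) : U (boundaries0 (F_complex Y)) :=
  inv_in (unit_cycle_fixed z).

Local Notation incl := (im_incl (diff1 (F_complex Y))).

Lemma U_incl_injective : injective (Umap incl).
Proof.
move=> v w /(congr1 (inv_val I _)) E; apply: inv_val_inj.
exact: im_lval_inj.
Qed.

Lemma unit_cycle_incl z : Umap incl (unit_cycle_fun z) = unit_map _ (ker_val z).
Proof. exact: inv_val_inj. Qed.

Fact unit_cycle_linear : linear unit_cycle_fun.
Proof.
by move=> h z z'; apply: U_incl_injective; rewrite linearP !unit_cycle_incl !linearP.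
Qed.

Definition unit_cycle : {linear cycles0 Y -> U (boundaries0 (F_complex Y))} :=
  mk_linear unit_cycle_linear.

Lemma unit_cycle_injective : injective unit_cycle.
Proof.
move=> z z' /(congr1 (Umap incl)); rewrite !unit_cycle_incl.
by move/(unit_injective (@projY _))/ker_val_inj.
Qed.

(** An invariant vector of B_0 FY is 1_I \otimes y for some y in Y_0.  It is a
    cycle of FY, so 1_I \otimes d_0 y = 0 and d_0 y = 0 since the unit is
    injective. *)
Lemma unit_cycle_surjective w : exists z, unit_cycle z = w.
Proof.
have [y yw] := unit_surjective (@projY 0) (Umap incl w).
have dy : cdiff_lin Y 0 y = 0.
  apply: (unit_injective (@projY _)); rewrite linear0.
  apply: etrans (esym (unit_nat (cdiff_lin Y 0) y)) _; rewrite yw.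
  apply: inv_val_inj; have [b bw] := im_valP (inv_val I _ w).
  change ((cdiff (F_complex Y) 0 : rep_hom _ _) (im_lval (inv_val I _ w)) = 0).
  by rewrite -bw; exact: diff1K.
by exists (ker_in dy); apply: U_incl_injective; rewrite unit_cycle_incl.
Qed.

End UnitSide.

Lemma unit_cycle_nat (Y Y' : complex (Mod (hecke k I)))
    (acY : acyclic Y) (acY' : acyclic Y') (f : chain_map Y Y') z :
  Umap (boundaries0_map (termwise_map (@functorF0 k p G I) f)) (unit_cycle acY z) =
  unit_cycle acY' (cycles0_map f z).
Proof.
apply: U_incl_injective; rewrite unit_cycle_incl.
apply: etrans (unit_nat (f 0) (ker_val z)).
exact: inv_val_inj.
Qed.

Section CounitSide.
Context (Y : complex (Mod (hecke k I))).
Hypotheses (acY : acyclic Y) (projY : forall n, projective_module (Y n)).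
Hypothesis noeth : left_noetherian (hecke k I).
Hypothesis injdim : finite_injdim ((hecke k I)^o : lmodType (hecke k I)).
Context (V : smooth_rep k G) (theta : {linear cycles0 Y -> U V}).
Hypotheses (theta_inj : injective theta)
  (theta_surj : forall v, exists z, theta z = v).

Definition cycle_counit : rep_hom (F (Y 1 : lmodType _)) V :=
  rhom_comp (counit I V) (Fmap (lin_comp theta (to_cycles Y))).

Lemma d1_to_cycles y : (d1 Y y = 0 <-> to_cycles Y y = 0).
Proof.
split=> [y0|/(congr1 ker_val)]; last by rewrite linear0.
by apply: ker_val_inj; rewrite linear0.
Qed.

(** Embed V in X_0 as the boundaries of an I-exact complex X of I-projectives.
    Let pi : Y_1 -> UV be the composite with theta.  Extending UV -> UX_0 to Y_0
    gives U(a) pi = g d_1, whence ker F(d_1) is killed in X_0, so in V.  Extending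
    UV = Z_0 Y -> Y_0 to UX_0 gives d_1 = g' U(a) pi; as F U X_0 = X_0, an element
    of FY_1 killed in V is killed by F(d_1).  Finally UX_1 -> UV lifts to Y_1,
    which makes FY_1 -> V onto because F U X_1 = X_1 maps onto V. *)
Lemma boundaries_counit : I_gorenstein_projective I V ->
  exists f : rep_hom (boundaries0 (F_complex Y)) V,
    @is_iso (Rep k G) _ _ f /\ forall b, f (boundary_class b) = cycle_counit b.
Proof.
move=> /I_gorenstein_presentation[X [a [projX exX a_inj a_im]]].
pose pi := lin_comp theta (to_cycles Y).
have pi_surj v : exists y, pi y = v.
  have [z <-] := theta_surj v; have [y <-] := to_cycles_surjective acY z.
  by exists y.
have pi0 y : pi y = 0 <-> d1 Y y = 0.
  split=> [|/d1_to_cycles y0]; last exact: etrans (congr1 theta y0) (linear0 theta).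
  by rewrite -(linear0 theta) => /theta_inj/d1_to_cycles.
have acX := U_complex_acyclic exX.
have aC b : a (cycle_counit b) = counit I _ (Fmap (Umap a) (Fmap pi b)).
  by rewrite counit_nat.
have Ua_inj : injective (Umap a).
  move=> v w /(congr1 (inv_val I _)) E; apply: inv_val_inj; exact: a_inj.
have [g gP] : exists g : {linear (Y 0 : lmodType _) -> U (X 0)},
    forall y, g (d1 Y y) = Umap a (pi y).
  apply: (extend_d1 (f := lin_comp (Umap a) pi)).
    apply: projective_hom_exact => //; exact: I_projective_projective.
  by move=> y /pi0 /= ->; rewrite linear0.
(* A lift of UX_1 -> UV to Y_1. *)
have [b bP] : exists b : {linear (U_complex I X 1 : lmodType _) -> (Y 1 : lmodType _)},
    forall x, Umap a (pi (b x)) = d1 (U_complex I X) x.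
  have [//|x|b bP] := @projective_lift _ _ _ _ (lin_comp (Umap a) pi) (d1 (U_complex I X)).
  - exact: I_projective_projective.
  - have [v vx] := presentation_surjective a_inj a_im exX (to_cycles _ x).
    have [y yv] := pi_surj v; exists y.
    exact: etrans (congr1 (Umap a) yv) (congr1 ker_val vx).
  - by exists b.
have [g' g'P] : exists g' : {linear (U_complex I X 0 : lmodType _) -> (Y 0 : lmodType _)},
    forall x, g' (d1 (U_complex I X) x) = d1 Y (b x).
  apply: (extend_d1 (f := lin_comp (d1 Y) b)).
    exact: U_complex_hom_exact.
  move=> x dx; apply/pi0; apply: Ua_inj; rewrite linear0 -dx; exact: bP.
(* Both sides agree on im b and vanish on ker pi = ker d_1, and these span Y_1. *)
have d1E y : d1 Y y = g' (Umap a (pi y)).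
  have [v vy] := cycle_boundary acX (presentation_cycle a_im (pi y)).
  have bv : d1 Y (y - b v) = 0.
    apply/pi0; rewrite linearB; apply/eqP; rewrite subr_eq0; apply/eqP.
    by apply: Ua_inj; rewrite bP vy.
  by rewrite -vy g'P; apply/subr0_eq; rewrite -linearB.
apply: image_iso => [c|v].
  split=> [Dc|Cc].
    apply: a_inj; rewrite aC linear0 -Fmap_comp.
    rewrite -(Fmap_eq (f := lin_comp g (d1 Y))) => [|y]; last exact: gP.
    by rewrite Fmap_comp; rewrite (Dc : Fmap (d1 Y) c = 0) !linear0.
  have U0 : Fmap (Umap a) (Fmap pi c) = 0.
    by apply: (counit_injective (projX 0)); rewrite -aC Cc !linear0.
  change (Fmap (d1 Y) c = 0).
  rewrite (Fmap_eq (g := lin_comp g' (lin_comp (Umap a) pi))) => [|y]; last exact: d1E.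
  by rewrite 2!Fmap_comp U0 linear0.
have [x xv] := (a_im (a v)).1 (ex_intro _ v erefl).
have [z zx] := counit_surjective (projX 1) x.
exists (Fmap b z); apply: a_inj; rewrite aC -!Fmap_comp -xv -zx.
rewrite -(counit_nat (diff1 X)); congr (counit I _ _).
by apply: Fmap_eq => y; exact: bP.
Qed.

End CounitSide.
End FComplex.

(** * The equivalence *)

Section Equivalence.
Context (k : fieldType) (p : nat) (G : topologicalGroupType).
Context (I : open_pro_p p G).
Context (Y : gproj_resolution (hecke k I)).
Implicit Types M N : lmodType (hecke k I).
Local Notation U := (inv_mod I).
Local Notation Umap := (inv_map I).
Local Notation F := ind_tensor.
Local Notation Fmap := ind_tensor_map.
Local Notation YC M := (gpY Y M : complex (Mod (hecke k I))).
Local Notation Ymap f := (fmor (gpY Y) f : chain_map _ _).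

Lemma boundary_class_nat (C D : complex (Mod (hecke k I))) (f : chain_map C D) b :
  boundaries0_map (termwise_map (@functorF0 k p G I) f) (boundary_class b) =
  boundary_class (Fmap (f 1) b).
Proof.
apply: im_lval_inj.
have E := cmap_diff (termwise_map (@functorF0 k p G I) f) 1.
exact: (esym (congr1 (fun h : rep_hom _ _ => h b) E)).
Qed.

Lemma to_cycles_nat (R : pzRingType) (C D : complex (Mod R)) (f : chain_map C D) y :
  cycles0_map f (to_cycles C y) = to_cycles D ((f 1 : {linear _ -> _}) y).
Proof.
apply: ker_val_inj.
exact: (esym (congr1 (fun h : {linear _ -> _} => h y) (cmap_diff f 1))).
Qed.

Lemma F_gorenstein M : gorenstein_projective M ->
  I_gorenstein_projective I (functorFF Y M).
Proof.
move=> /(gpY_gproj Y M) projY.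
exists (F_complex (YC M)); split=> [n||].
- exact/I_projective_free/projY.
- by apply: F_complex_I_exact; [exact: gpY_acyclic|exact: projY].
- by exists (idm _), (idm _); rewrite !comp1m.
Qed.

Lemma iso_bij (R : pzRingType) (M N : lmodType R) (f : {linear M -> N}) :
  @is_iso (Mod R) M N f ->
  injective f /\ forall n, exists m, f m = n.
Proof.
move=> [g [gf fg]]; split=> [|n].
  apply: (can_inj (g := (g : {linear _ -> _}))) => m.
  exact: (congr1 (fun h : {linear _ -> _} => h m) gf).
exists ((g : {linear _ -> _}) n).
exact: (congr1 (fun h : {linear _ -> _} => h n) fg).
Qed.

Context (eta : forall M, {linear cycles0 (YC M) -> M}).
Hypothesis eta_iso : forall M, @is_iso (Mod (hecke k I)) _ _ (eta M).
Hypothesis eta_nat : forall M N (f : {linear M -> N}) z,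
  eta N (cycles0_map (Ymap f) z) = f (eta M z).

Lemma unit_iso M : gorenstein_projective M ->
  exists f : {linear U (functorFF Y M) -> M},
    @is_iso (Mod (hecke k I)) _ _ f /\
    forall z, f (unit_cycle (@gpY_acyclic _ Y M) z) = eta M z.
Proof.
move=> /(gpY_gproj Y M) projY.
have ub := unit_cycle_surjective (@gpY_acyclic _ Y M) projY.
have ui : injective (unit_cycle (@gpY_acyclic _ Y M)) :=
  unit_cycle_injective projY.
have [eta_inj eta_surj] := iso_bij (eta_iso M).
have [g [ug gu]] := linear_inverse ui ub.
exists (lin_comp (eta M) g); split; last by move=> z; exact: congr1 (ug z).
apply: linear_iso => [w w' /eta_inj|m]; first exact: (can_inj gu).
have [z <-] := eta_surj m; exists (unit_cycle (@gpY_acyclic _ Y M) z).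
exact: congr1 (ug z).
Qed.

Hypothesis noeth : left_noetherian (hecke k I).
Hypothesis injdim : finite_injdim ((hecke k I)^o : lmodType (hecke k I)).

Lemma counit_iso (V : smooth_rep k G) : I_gorenstein_projective I V ->
  exists f : rep_hom (functorFF Y (U V)) V,
    @is_iso (Rep k G) _ _ f /\
    forall b, f (boundary_class b) = cycle_counit (eta (U V)) b.
Proof.
move=> VG; have [eta_inj eta_surj] := iso_bij (eta_iso (U V)).
apply: boundaries_counit => //; first exact: gpY_acyclic.
exact/(gpY_gproj Y)/U_gorenstein.
Qed.

(** The naturality, in V, of the isomorphism of the preceding lemma: both sides
    unfold to the counit at W applied to one and the same map out of Y_1. *)
Lemma cycle_counit_nat (V W : smooth_rep k G) (f : rep_hom V W) b :
  f (cycle_counit (eta (U V)) b) =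
  cycle_counit (eta (U W)) (Fmap (Ymap (Umap f) 1) b).
Proof.
change (f (counit I V (Fmap (lin_comp (eta (U V)) (to_cycles (YC (U V)))) b)) =
  counit I W (Fmap (lin_comp (eta (U W)) (to_cycles (YC (U W))))
    (Fmap (Ymap (Umap f) 1) b))).
rewrite -counit_nat -!Fmap_comp; congr (counit I W _); apply: Fmap_eq => y.
by rewrite /= -eta_nat to_cycles_nat.
Qed.

End Equivalence.

Theorem theorem5p4 (p : nat) (k : fieldType) (G : topologicalGroupType)
    (I : open_pro_p p G) (char_k : p \in [pchar k])
    (H_gorenstein : gorenstein_ring (hecke k I))
    (Y : gproj_resolution (hecke k I)) :
  exists
    (U_gproj : forall V : Rep k G, I_gorenstein_projective I V ->
       gorenstein_projective (functorU k I V))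
    (F_gproj : forall M : Mod (hecke k I), gorenstein_projective M ->
       I_gorenstein_projective I (functorFF Y M)),
    inverse_equivalences (restrict U_gproj) (restrict F_gproj).
Proof.
have [noeth _ injdim _] := H_gorenstein.
have [etaC [eta_iso eta_natC]] := gpY_cycles Y.
pose eta (M : lmodType (hecke k I)) :
  {linear cycles0 (gpY Y M : complex (Mod (hecke k I))) -> M} := etaC M.
have eta_nat (M N : lmodType (hecke k I)) (f : {linear M -> N}) z :
    eta N (cycles0_map (fmor (gpY Y) f : chain_map _ _) z) = f (eta M z).
  exact: (congr1 (fun h : {linear _ -> _} => h z) (eta_natC M N f)).
exists (U_gorenstein noeth injdim), (@F_gorenstein k p G I Y); split.
  pose cS V := cid (counit_iso eta_iso noeth injdim (svalP V)).
  pose c V := projT1 (cS V).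
  have cP V : @is_iso (Rep k G) _ _ (c V) /\ _ := projT2 (cS V).
  exists c; split=> [V|V W f].
    have [[g [gc cg]] _] := cP V; exists g; split; [exact: gc|exact: cg].
  apply: rep_hom_eq => w; have [b <-] := im_classP w.
  apply: etrans (congr1 (c W) (boundary_class_nat _ b)) _.
  rewrite (cP W).2; apply: etrans (esym (cycle_counit_nat eta_nat _ _)) _.
  exact: congr1 (esym ((cP V).2 b)).
pose uS M := cid (unit_iso eta_iso (svalP M)).
pose u M := projT1 (uS M).
have uP M : @is_iso (Mod (hecke k I)) _ _ (u M) /\ _ := projT2 (uS M).
exists u; split=> [M|M N f].
  have [[g [gu ug]] _] := uP M; exists g; split; [exact: gu|exact: ug].
apply: linear_eq => w.
have projY := (gpY_gproj Y (sval M)).1 (svalP M).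
have [z <-] := unit_cycle_surjective (@gpY_acyclic _ Y (sval M)) projY w.
apply: etrans (congr1 (u N) (unit_cycle_nat (@gpY_acyclic _ Y (sval M))
  (@gpY_acyclic _ Y (sval N)) _ z)) _.
rewrite (uP N).2; apply: etrans (eta_nat _ _ _ _) _.
exact: congr1 (esym ((uP M).2 z)).
Qed.
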